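(* (Exponential decay of $\psi$-mixing coefficients along the return sequence $(l_n)$.) Let $(X,T,\Omega,P,\theta)$ be a random countable topological Markov chain with the b.i.p.-property and let $\varphi$ be a potential such that $(\hat{\mathrm{H}})$ holds and $\mathcal{L}_\omega(1)=1$ a.s. Let $\{\mu_\omega\}$ be the unique random probability measure with $\mathcal{L}^\ast_\omega(\mu_{\theta\omega})=\mu_\omega$ a.s., and define $$\psi_n(\omega):=\sup\frac{\mu_{\theta^{-k}\omega}\big([a]_{\theta^{-k}\omega}\cap(T^{k+n}_{\theta^{-k}\omega})^{-1}(A)\big)-\mu_{\theta^{-k}\omega}([a]_{\theta^{-k}\omega})\,\mu_{\theta^n\omega}(A)}{\mu_{\theta^{-k}\omega}([a]_{\theta^{-k}\omega})\,\mu_{\theta^n\omega}(A)},$$ where the supremum is over all $k\in\mathbb{N}$, $a\in\mathcal{W}^k_{\theta^{-k}\omega}$ and measurable $A\subset X_{\theta^n\omega}$ with $\mu_{\theta^{-k}\omega}([a]_{\theta^{-k}\omega})>0$ and $\mu_{\theta^n\omega}(A)>0$. Let $B_\ast\ge1$ and $C_\ast>0$ be constants such that $\Omega_\ast:=\{\omega: B_\omega\le B_\ast,\ C_\omega\ge C_\ast\}$ has positive measure (the random variables $B_\omega$, $C_\omega$, $m_\omega$ are defined in the context). Put $$t:=1-\frac{C_\ast}{2B_\ast}\in(0,1),\qquad n_\omega:=\min\Big\{n\in\mathbb{N}:\ \theta^n\omega\in\Omega_\ast,\ n\ge\big\lfloor-\log(4B_\omega)/\log r\big\rfloor+1\Big\},$$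 and define the random sequence $(l_n(\omega))$ by $l_0(\omega):=n_\omega$ and, for $n\ge1$, $$l_n(\omega):=l_{n-1}(\omega)+m_{\theta^{l_{n-1}(\omega)}\omega}+n_{\theta^{l^\ast}\omega},\qquad l^\ast:=l_{n-1}(\omega)+m_{\theta^{l_{n-1}(\omega)}\omega}.$$ Thus $\theta^{l_n(\omega)}\omega\in\Omega_\ast$ for all $n$, and $l_n(\omega)-l_{n-1}(\omega)\ge L(\theta^{l_{n-1}(\omega)}\omega)$ with $L(\omega):=m_\omega+n_{\theta^{m_\omega}\omega}$. Then there exist a set $\Omega'\subset\Omega_{\rm bi}$ of positive measure and $C>0$ such that, for all $\omega\in\Omega'$ and $n\in\mathbb{N}$, $$\psi_{l_n(\omega)}(\omega)\le C\,t^n.$$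
   Context: **Random countable topological Markov chain.** $\theta$ is an ergodic automorphism (invertible, bimeasurable, probability preserving, ergodic) of a probability space $(\Omega,\mathcal{F},P)$; $\{\mathcal{W}^1_\omega\}$ is a measurable family of subsets of $\mathbb{N}$; for a.e. $\omega$, $A_\omega=(\alpha^\omega_{ij}:i\in\mathcal{W}^1_\omega,j\in\mathcal{W}^1_{\theta\omega})$ is a matrix with entries in $\{0,1\}$, measurable in $\omega$, with $\sum_{j\in\mathcal{W}^1_{\theta\omega}}\alpha^\omega_{ij}>0$ and $\sum_{j\in\mathcal{W}^1_{\theta^{-1}\omega}}\alpha^{\theta^{-1}\omega}_{ji}>0$ for all $i\in\mathcal{W}^1_\omega$. Put $X_\omega=\{(x_0,x_1,\dots):\alpha^{\theta^i\omega}_{x_ix_{i+1}}=1\ \forall i\ge0\}$, $T_\omega:X_\omega\to X_{\theta\omega}$ the shift, $X=\{(\omega,x):x\in X_\omega\}$ (measurable structure induced from $\mathbb{N}^{\mathbb{N}}\times\Omega$), $T(\omega,x)=(\theta\omega,T_\omega x)$, $T^n_\omega=T_{\theta^{n-1}\omega}\circ\cdots\circ T_\omega$. $\mathcal{W}^n_\omega$ is the set of $\omega$-admissible words $(x_0,\dots,x_{n-1})$, i.e. $x_i\in\mathcal{W}^1_{\theta^i\omega}$ and $\alpha^{\theta^i\omega}_{x_ix_{i+1}}=1$ for consecutive letters; $[a]_\omega=\{x\in X_\omega:x_i=a_i,\ 0\le i<n\}$; for $a\in\mathcal{W}^n_\omega$, $\tau_a:T^n_\omega([a]_\omega)\to[a]_\omega$,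 $x\mapsto ax$, is the inverse branch; $\Omega_a=\{\omega:[a]_\omega\neq\emptyset\}$; $\mathcal{W}^n$ is the set of words $a$ of length $n$ with $P(\Omega_a)>0$. **Random probability measure** $\mu=\{\mu_\omega\}$: a map $(B,\omega)\mapsto\mu_\omega(B)\in[0,1]$ on (Borel sets of $\mathbb{N}^{\mathbb{N}}$)$\times\Omega$ which is measurable in $\omega$ for each $B$ and such that, for a.e. $\omega$, $\mu_\omega$ is a probability measure with support $X_\omega$. **b.i.p.-property.** $(X,T)$ is topologically mixing if for all $a,b\in\mathcal{W}^1$ there is an $\mathbb{N}$-valued random variable $N_{ab}$ such that $[a]_\omega\cap(T^n_\omega)^{-1}[b]_{\theta^n\omega}\neq\emptyset$ whenever $n\ge N_{ab}(\omega)$, $a\in\mathcal{W}^1_\omega$ and $\theta^n\omega\in\Omega_b$. $(X,T)$ has the b.i.p.-property if it is topologically mixing and there are $\Omega_{\rm bi},\Omega_{\rm bp}\subset\Omega$ of positive measure and a finite $\mathcal{I}\subset\mathbb{N}$ such that (1) for $\omega\in\Omega_{\rm bi}$, $a\in\mathcal{W}^1_{\theta^{-1}\omega}$ there is $b\in\mathcal{I}$ with $ab\in\mathcal{W}^2_{\theta^{-1}\omega}$; (2) for $\omega\in\Omega_{\rm bp}$, $a\in\mathcal{W}^1_\omega$ there is $b\in\mathcal{I}$ with $ba\in\mathcal{W}^2_{\theta^{-1}\omega}$. **Hölder continuity and Ruelle operator.** For $f:X\to\mathbb{R}$, $V^\omega_n(f)=\sup\{|f_\omega(x)-f_\omega(y)|:x_i=y_i,\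 0\le i<n\}$. $f$ is locally Hölder continuous with parameter $r\in(0,1)$ and index $k$ if there is a random variable $\kappa\ge0$ with $\int\log\kappa\,dP<\infty$ and $V^\omega_n(f)\le\kappa(\omega)r^n$ for all $n\ge k$. For measurable $\varphi:X\to\mathbb{R}$, $\mathcal{L}_\omega(f)(x)=\sum_{y\in X_\omega:T_\omega y=x}e^{\varphi_\omega(y)}f(y)$ ($x\in X_{\theta\omega}$), $\int f\,d\mathcal{L}_\omega^\ast(\mu)=\int\mathcal{L}_\omega(f)\,d\mu$, and $S_n\varphi_\omega=\sum_{k=0}^{n-1}\varphi_{\theta^k\omega}\circ T^k_\omega$. $(\hat{\mathrm{H}})$: $\varphi$ is locally Hölder continuous with index $2$ (with parameter $r$ and random variable $\kappa$) and $V^\omega_1(\varphi)<\infty$ for a.e. $\omega\in\theta^{-1}(\Omega_{\rm bi}\cup\Omega_{\rm bp})$. **The random variables $B_\omega$, $m_\omega$, $C_\omega$.** $B_\omega:=\exp\sum_{k=1}^\infty\kappa(\theta^{-k}\omega)r^k$. Fix an $\mathbb{N}$-valued random variable $\mathbf{o}_\omega$ with $\mathbf{o}_\omega\in\mathcal{W}^1_\omega$ (e.g. $\mathbf{o}_\omega=\min\mathcal{W}^1_\omega$). Let $$m_\omega:=\min\{n\ge1:\ \theta^n\omega\in\Omega_{\rm bp},\ (A_\omega A_{\theta\omega}\cdots A_{\theta^{n-2}\omega})_{\mathbf{o}_\omega j}\ge1\ \ \forall j\in\mathcal{I}\cap\mathcal{W}^1_{\theta^{n-1}\omega}\}$$ (empty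 product = identity), which is a.s. finite. For $x\in X_{\theta^{m_\omega}\omega}$ let $u(x)=(u_0,\dots,u_{m_\omega-1})\in\mathcal{W}^{m_\omega}_\omega$ be the lexicographically minimal word with $u_0=\mathbf{o}_\omega$, $u_{m_\omega-1}\in\mathcal{I}$ and $x\in T^{m_\omega}_\omega([u(x)]_\omega)$. Put $$C_\omega:=\inf_{x\in X_{\theta^{m_\omega}\omega}}e^{S_{m_\omega}\varphi_\omega(\tau_{u(x)}x)}>0\quad\text{a.s.}$$ A random sequence is a sequence of measurable $\mathbb{N}$-valued functions of $\omega$. *)

(* Defs.v *)
(* MathComp-Analysis, over an arbitrary [R : realType]. *)
From HB Require Import structures.
From mathcomp Require Import all_boot all_order all_algebra.
From mathcomp Require Import all_classical all_reals all_analysis.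
From mathcomp Require Import measurable_realfun.
Set Implicit Arguments.
Unset Strict Implicit.
Unset Printing Implicit Defensive.
Import Order.TTheory GRing.Theory Num.Theory.
Import numFieldNormedType.Exports.
Local Open Scope classical_set_scope.
Local Open Scope ring_scope.

(* N^N with the Borel sigma-algebra of the product (pointwise) topology *)
Definition NN := g_sigma_algebraType (@open {ptws nat -> nat}).

Definition shiftNN (x : NN) : NN := fun i => x i.+1.

(* the concatenation ux of a finite word u and an infinite word x *)
Definition prepend (u : seq nat) (x : NN) : NN :=
  fun i => if (i < size u)%N then nth 0%N u i else x (i - size u)%N.

Definition msupport (R : realType) (nu : set NN -> \bar R) : set NN :=
  [set x | forall U : set {ptws nat -> nat}, open U -> U x -> (0 < nu U)%E].

(* the least element of a set of naturals; the junk value is 0 on set0 *)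
Definition nat_min (A : set nat) : nat :=
  xget 0%N [set n | A n /\ forall k, A k -> (n <= k)%N].

(* the lexicographically least word of a set of words of the same length *)
Definition lex_min (A : set (seq nat)) : seq nat :=
  xget [::] [set u | A u /\
    forall v, A v -> ((u : seqlexi nat) <= (v : seqlexi nat))%O].

Section base.
Context {d : measure_display} {Omega : measurableType d} {R : realType}.
Variable P : probability Omega R.

(* Positive measure, for sets that are only measurable for the completion of P
   (Omega need not be complete). For a measurable set A, or one in the
   completion, this is exactly "P A > 0". *)
Definition positive_measure (A : set Omega) : Prop :=
  exists E, [/\ measurable E, E `<=` A & (0 < P E)%E].

Record ergodic_automorphism (theta thetaV : Omega -> Omega) : Prop := {
  theta_cancel : cancel theta thetaV;
  thetaV_cancel : cancel thetaV theta;
  theta_measurable : measurable_fun setT theta;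
  thetaV_measurable : measurable_fun setT thetaV;
  theta_preserving : forall A, measurable A -> P (theta @^-1` A) = P A;
  theta_ergodic : forall A, measurable A -> theta @^-1` A = A ->
    P A = 0%E \/ P A = 1%E }.

(* Random countable topological Markov chain.  The matrix A_w is indexed by
   W1 w and W1 (theta w): the values of [alpha w] off these index sets are
   irrelevant, and every definition below only reads entries inside them. *)
Record randomTMC := RandomTMC {
  theta : Omega -> Omega;
  thetaV : Omega -> Omega;
  W1 : Omega -> set nat;
  alpha : Omega -> nat -> nat -> bool;
  base_automorphism : ergodic_automorphism theta thetaV;
  W1_measurable : forall i, measurable [set w | W1 w i];
  alpha_measurable : forall i j,
    measurable [set w | [/\ W1 w i, W1 (theta w) j & alpha w i j]];
  alpha_rows : {ae P, forall w, forall i, W1 w i ->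
    (0 < \esum_(j in W1 (theta w)) (alpha w i j)%:R%:E :> \bar R)%E};
  alpha_cols : {ae P, forall w, forall i, W1 w i ->
    (0 < \esum_(j in W1 (thetaV w)) (alpha (thetaV w) j i)%:R%:E :> \bar R)%E}
}.

End base.

Section chain.
Context {d : measure_display} {Omega : measurableType d} {R : realType}.
Context {P : probability Omega R}.
Variable S : randomTMC P.
Implicit Types (w : Omega) (x y : NN) (a u : seq nat) (f : Omega -> NN -> R).

Local Notation "'th^' n" := (iter n (theta S)) (at level 2, n at level 1).
Local Notation "'thV^' n" := (iter n (thetaV S)) (at level 2, n at level 1).

(* X_w; membership of the letters in the alphabets makes the entries of the
   matrices meaningful *)
Definition Xfib w : set NN := [set x | forall i,
  [/\ W1 S (th^ i w) (x i), W1 S (th^ i.+1 w) (x i.+1)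
    & alpha S (th^ i w) (x i) (x i.+1)]].

Definition Xtot : set (Omega * NN) := [set p | Xfib p.1 p.2].

Definition words w (n : nat) : set (seq nat) := [set a |
  [/\ size a = n,
      (forall i, (i < n)%N -> W1 S (th^ i w) (nth 0%N a i))
    & (forall i, (i.+1 < n)%N ->
         alpha S (th^ i w) (nth 0%N a i) (nth 0%N a i.+1))]].

Definition cyl w a : set NN :=
  [set x | Xfib w x /\ forall i, (i < size a)%N -> x i = nth 0%N a i].

Definition Omega_of a : set Omega := [set w | cyl w a !=set0].

Definition global_words (n : nat) : set (seq nat) :=
  [set a | size a = n /\ positive_measure P (Omega_of a)].

Definition mixing : Prop :=
  forall a b, global_words 1 a -> global_words 1 b ->
  exists N : Omega -> nat, measurable_fun setT N /\
    {ae P, forall w, forall n, (N w <= n)%N -> words w 1 a ->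
       Omega_of b (th^ n w) ->
       cyl w a `&` iter n shiftNN @^-1` cyl (th^ n w) b !=set0}.

(* the b.i.p.-property, realised by the given Omega_bi, Omega_bp and I *)
Record bip (Obi Obp : set Omega) (I : set nat) : Prop := {
  bip_mixing : mixing;
  bip_bi_measurable : measurable Obi;
  bip_bi_positive : (0 < P Obi)%E;
  bip_bp_measurable : measurable Obp;
  bip_bp_positive : (0 < P Obp)%E;
  bip_finite : finite_set I;
  bip_bi : forall w, Obi w -> forall a : nat, W1 S (thetaV S w) a ->
    exists2 b, I b & words (thetaV S w) 2 [:: a; b];
  bip_bp : forall w, Obp w -> forall a : nat, W1 S w a ->
    exists2 b, I b & words (thetaV S w) 2 [:: b; a] }.

Definition variation f (n : nat) w : \bar R :=
  ereal_sup [set e | exists x y, [/\ Xfib w x, Xfib w y,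
    (forall i, (i < n)%N -> x i = y i) & e = `|f w x - f w y|%:E]].

(* The integral of log kappa may be -oo; it is well defined and < +oo exactly
   when the positive part has finite integral ([lne] maps 0 to -oo). *)
Record locally_holder f (r : R) (k : nat) (kappa : Omega -> R) : Prop := {
  kappa_measurable : measurable_fun setT kappa;
  kappa_ge0 : forall w, 0 <= kappa w;
  kappa_log : (\int[P]_w (((fun v => lne (kappa v)%:E) ^\+) w) < +oo)%E;
  variation_le : {ae P, forall w, forall n, (k <= n)%N ->
    (variation f n w <= (kappa w * r ^+ n)%:E)%E} }.

(* condition (H^) *)
Record holder_hat f (r : R) (kappa : Omega -> R) (Obi Obp : set Omega) :
    Prop := {
  hat_holder : locally_holder f r 2 kappa;
  hat_variation1 : {ae P, forall w, (theta S @^-1` (Obi `|` Obp)) w ->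
    (variation f 1 w < +oo)%E} }.

Section potential.
Variable phi : Omega -> NN -> R.

Definition birkhoff (n : nat) w x : R :=
  \sum_(k < n) phi (th^ k w) (iter k shiftNN x).

Definition ruelle w (g : NN -> \bar R) (x : NN) : \bar R :=
  (\esum_(y in [set y | Xfib w y /\ shiftNN y = x]) (expR (phi w y))%:E * g y)%E.

(* nu' = L_w^* nu, tested against the nonnegative measurable functions *)
Definition is_ruelle_dual w (nu nu' : set NN -> \bar R) : Prop :=
  forall g : NN -> \bar R, measurable_fun (Xfib w) g ->
    (forall x, Xfib w x -> (0 <= g x)%E) ->
    (\int[nu']_(x in Xfib w) g x =
     \int[nu]_(x in Xfib (theta S w)) ruelle w g x)%E.

End potential.

(* The values of [mu w] on nonmeasurable sets carry no information: any random
   probability measure given on the Borel sets can be extended by 0. *)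
Record random_probability (mu : Omega -> set NN -> \bar R) : Prop := {
  rp_01 : forall B w, measurable B -> (0 <= mu w B <= 1)%E;
  rp_measurable : forall B, measurable B -> measurable_fun setT (mu ^~ B);
  rp_ae : {ae P, forall w,
    (exists nu : probability NN R, mu w = nu) /\ msupport (mu w) = Xfib w} }.

Definition psi (mu : Omega -> set NN -> \bar R) (n : nat) w : \bar R :=
  ereal_sup [set e | exists (k : nat) a (A : set NN),
    let v := thV^ k w in
    let p := fine (mu v (cyl v a)) * fine (mu (th^ n w) A) in
    [/\ words v k a, measurable A, A `<=` Xfib (th^ n w),
        (0 < mu v (cyl v a))%E /\ (0 < mu (th^ n w) A)%E
      & e = ((fine (mu v (cyl v a `&` iter (k + n) shiftNN @^-1` A)) - p)
               / p)%:E]].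

(* entry (i, j) of A_w A_{theta w} ... A_{theta^{n-1} w}, possibly +oo since
   the alphabets may be infinite; the identity for n = 0 *)
Fixpoint mxprod (n : nat) w (i j : nat) : \bar R :=
  if n is n'.+1 then
    (\esum_(l in W1 S (theta S w))
       (alpha S w i l)%:R%:E * mxprod n' (theta S w) l j)%E
  else (i == j)%:R%:E.

Section constants.
Variables (Obp : set Omega) (I : set nat) (o : Omega -> nat).
Variables (phi : Omega -> NN -> R) (r : R) (kappa : Omega -> R).

Definition m_ w : nat := nat_min [set n | [/\ (1 <= n)%N, Obp (th^ n w) &
  forall j, (I `&` W1 S (th^ n.-1 w)) j -> (1 <= mxprod n.-1 w (o w) j)%E]].

(* u(x) *)
Definition u_ w x : seq nat := lex_min [set u |
  [/\ words w (m_ w) u, nth 0%N u 0 = o w, I (nth 0%N u (m_ w).-1)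
    & (iter (m_ w) shiftNN @` cyl w u) x]].

Definition B_ w : \bar R :=
  expeR (\sum_(1 <= k <oo) (kappa (thV^ k w) * r ^+ k)%:E)%E.

Definition C_ w : \bar R := ereal_inf
  [set (expR (birkhoff phi (m_ w) w (prepend (u_ w x) x)))%:E
     | x in Xfib (th^ (m_ w) w)].

Variables (Bstar Cstar : R).

Definition Omega_star : set Omega :=
  [set w | (B_ w <= Bstar%:E)%E /\ (Cstar%:E <= C_ w)%E].

(* B_ is a.s. finite, so [fine] only matters on a null set *)
Definition n_ w : nat := nat_min [set n | Omega_star (th^ n w) /\
  (Num.floor (- ln (4 * fine (B_ w)) / ln r) + 1 <= n%:Z)%R].

Fixpoint l_ (n : nat) w : nat :=
  if n is n'.+1 then
    let lstar := (l_ n' w + m_ (th^ (l_ n' w) w))%N in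
    (lstar + n_ (th^ lstar w))%N
  else n_ w.

End constants.

End chain.

(* Main.v *)
(* Write [L^n] for the iterated Ruelle operator. If [a] is a word of length [k]
   read at [v = theta^-k w], duality turns the mass of [a] followed by [A] after
   [n] further steps into the integral over [A] of [L^n h], where
   [h = L^k 1_[a]] has integral [q = mu_v [a]]. So it suffices that [L^{l_n} h]
   oscillates by at most [C q t^n].

   A function with oscillation [N] whose local variations are controlled by [N]
   is contracted in two stages. After [n_w] steps its variations are so small
   that truncating it below by them and using bounded distortion bounds its
   oscillation on each 1-cylinder by [(1 - 1/(2B)) N]. In the next [m] steps
   every point has a preimage in the 1-cylinder of [o], whose branch has weight
   at least [C]; this couples any two points and leaves the oscillation
   [(1 - C) N + C (1 - 1/(2B)) N = t N].

   The initial bound [h <= D q] holds with [D] finite for almost every [w] in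
   [Omega_bi]: the last letter of [a] can be followed by a letter of the finite
   set [I], and changing the next letter costs at most the first variation.
   Expressed through masses of cylinders, this bound with [D <= M] is a
   measurable condition on [w], which holds on a set of positive measure once
   [M] is large. *)
Require Import Defs.
From mathcomp Require Import all_boot all_order all_algebra.
From mathcomp Require Import all_classical all_reals all_analysis.
From mathcomp Require Import measurable_realfun.
From mathcomp Require Import ring lra zify.
Set Implicit Arguments.
Unset Strict Implicit.
Unset Printing Implicit Defensive.
Import Order.TTheory GRing.Theory Num.Theory.
Import numFieldNormedType.Exports.
Local Open Scope classical_set_scope.
Local Open Scope ring_scope.

(** * Pointwise topology and Borel sets of the sequence space *)

Section sequence_space.
Implicit Types (x y : NN) (u : seq nat).

Lemma NN_eval_near x (i : nat) :
  \forall y \near (x : {ptws nat -> nat}), (y : nat -> nat) i = x i.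
Proof.
have /pointwise_cvgP : {ptws, nbhs (x : {ptws nat -> nat}) --> (x : nat -> nat)}.
  exact: cvg_id.
by move=> /(_ i) /(_ [set x i]); apply; rewrite nbhs_principalE.
Qed.

Lemma NN_cvg (F : set_system NN) x : Filter F ->
  (forall i, F [set y : NN | y i = x i]) ->
  F `=>` nbhs (x : {ptws nat -> nat}).
Proof.
move=> FF Fx; apply/(pointwise_cvgP (F := F)) => i A Ai.
apply: (@filterS _ F _ _ _ _ (Fx i)) => y /= yx; rewrite yx; exact: nbhs_singleton.
Qed.

Lemma NN_coordinate_measurable (i a : nat) : measurable [set x : NN | x i = a].
Proof.
apply: sub_sigma_algebra; rewrite openE => x /= xa.
by apply: (filterS _ (NN_eval_near x i)) => y /= yx; rewrite yx.
Qed.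

(** If no length works, choose for each [n] a point outside [U] that agrees with [x] on [n] letters.
    These points converge to [x] and must enter [U], a contradiction. *)
Lemma NN_open_cylinder (U : set {ptws nat -> nat}) x : open U -> U x ->
  exists n : nat, forall y, (forall i, (i < n)%N -> y i = x i) -> U y.
Proof.
move=> oU Ux; apply: contrapT => /forallNP H.
have /choice[v vP] : forall n : nat, exists y : NN,
    (forall i, (i < n)%N -> y i = x i) /\ ~ U y.
  by move=> n; have /existsNP[y /not_implyP[? ?]] := H n; exists y.
have cvgv : v @ \oo `=>` nbhs (x : {ptws nat -> nat}).
  apply: NN_cvg => i; exists i.+1 => // n /= ni; exact: (vP n).1.
have [n _ /(_ n (leqnn n)) /=] := cvgv _ (open_nbhs_nbhs (conj oU Ux)).
exact: (vP n).2.
Qed.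

(** Each coordinate of the image is constant near a given point, so [f] is continuous for the
    pointwise topology. This covers the shift and the prepending of a letter. *)
Lemma NN_measurable_fun (f : NN -> NN) :
  (forall i, (exists j, forall x, f x i = x j) \/ (exists c, forall x, f x i = c)) ->
  measurable_fun setT f.
Proof.
move=> fE; apply: (@measurability _ _ NN NN setT f (@open {ptws nat -> nat})) => //.
move=> _ [U oU <-]; rewrite setTI; apply: sub_sigma_algebra.
rewrite openE => x Ux; rewrite /interior.
have /(_ U) : f @ nbhs (x : {ptws nat -> nat}) `=>` nbhs (f x : {ptws nat -> nat}).
  apply: NN_cvg => i.
  have : \forall y \near (x : {ptws nat -> nat}), (f y : nat -> nat) i = f x i.
    case: (fE i) => -[j fj]; last first.
      by apply: (@filterE _ (nbhs (x : {ptws nat -> nat}))) => y; rewrite /= !fj.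
    by apply: (@filterS _ (nbhs (x : {ptws nat -> nat})) _ _ _ _ (NN_eval_near x j)) => y /= yE; rewrite !fj.
  exact.
by apply; exact: open_nbhs_nbhs.
Qed.

Lemma shiftNN_measurable : measurable_fun setT shiftNN.
Proof. by apply: NN_measurable_fun => i; left; exists i.+1. Qed.

Lemma iter_shiftNNE n x i : iter n shiftNN x i = x (n + i)%N.
Proof. by elim: n i => [//|n IH] i /=; rewrite /shiftNN IH addnS. Qed.

Lemma iter_shiftNN_measurable n : measurable_fun setT (iter n shiftNN).
Proof.
apply: NN_measurable_fun => i; left; exists (n + i)%N => x; exact: iter_shiftNNE.
Qed.

Definition cylinder u : set NN :=
  [set x | forall i, (i < size u)%N -> x i = nth 0%N u i].

Lemma NN_prefix_near x (n : nat) : \forall y \near (x : {ptws nat -> nat}),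
  forall i, (i < n)%N -> (y : nat -> nat) i = x i.
Proof.
elim: n => [|n IH]; first by apply: (@filterS _ (nbhs (x : {ptws nat -> nat})) _ setT) => //; exact: filterT.
apply: (@filterS2 _ (nbhs (x : {ptws nat -> nat})) _ _ _ _ _
  IH (NN_eval_near x n)) => y /= yx yn i.
by rewrite ltnS leq_eqVlt => /predU1P[->|/yx].
Qed.

Lemma open_cylinder u : open (cylinder u : set {ptws nat -> nat}).
Proof.
rewrite openE => x xu; apply: (@filterS _ (nbhs (x : {ptws nat -> nat})) _ _ _ _
  (NN_prefix_near x (size u))) => y yx i iu.
by rewrite yx// xu.
Qed.

Lemma cylinder_measurable u : measurable (cylinder u).
Proof. by apply: sub_sigma_algebra; exact: open_cylinder. Qed.

Lemma cylinder_mkseq x n : cylinder (mkseq x n) x.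
Proof. by move=> i; rewrite size_mkseq => ni; rewrite nth_mkseq. Qed.

End sequence_space.

(** * Supports of probability measures on the sequence space *)

Section support.
Context (R : realType) (nu : probability NN R).

Lemma msupport_cylinder_gt0 (x : NN) (u : seq nat) :
  msupport nu x -> cylinder u x -> (0 < nu (cylinder u))%E.
Proof. by move=> nux ux; exact: (nux _ (open_cylinder u) ux). Qed.

(** A point off the support has a null open neighbourhood, which contains a null cylinder around it.
    There are countably many words, so the null cylinders cover the complement by a null set. *)
Lemma msupport_setC_negligible : nu.-negligible (~` msupport nu).
Proof.
pose N u : set NN := if nu (cylinder u) == 0%E then cylinder u else set0.
pose F n : set NN := if @unpickle (seq nat) n is Some u then N u else set0.
apply: (@negligibleS _ _ _ _ (\bigcup_n F n)); last first.
  apply: negligible_bigcup => n; rewrite /F; case: unpickle => [u|]; last first.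
    exact: negligible_set0.
  rewrite /N; case: eqP => [u0|_]; last exact: negligible_set0.
  by exists (cylinder u); split => //; exact: cylinder_measurable.
move=> x /existsNP[U /not_implyP[oU /not_implyP[Ux nuU]]].
have [n xn] := NN_open_cylinder oU Ux.
exists (pickle (mkseq x n)) => //; rewrite /F pickleK /N.
have subU : cylinder (mkseq x n) `<=` U.
  by move=> y yx; apply: xn => i ni; rewrite yx ?size_mkseq// nth_mkseq.
suff -> : nu (cylinder (mkseq x n)) == 0%E by exact: cylinder_mkseq.
rewrite eq_le measure_ge0 andbT leNgt; apply/negP => n0; apply: nuU.
rewrite (lt_le_trans n0)// le_measure ?inE//; last first.
- exact: sub_sigma_algebra.
- exact: cylinder_measurable.
Qed.

Lemma msupport_full (X : set NN) : measurable X -> msupport nu = X -> nu X = 1%E.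
Proof.
move=> mX supX; have := msupport_setC_negligible; rewrite supX => nX.
have n0 : nu (~` X) = 0%E by apply/negligibleP => //; exact: measurableC.
by rewrite -[X]setCK probability_setC ?n0 ?sube0//; exact: measurableC.
Qed.

End support.

(** * Inverse branches of the shift between fibres *)

Definition consNN (j : nat) (x : NN) : NN :=
  fun i => if i is i'.+1 then x i' else j.

Lemma shiftNN_consNN j x : shiftNN (consNN j x) = x.
Proof. by apply/funext. Qed.

Lemma consNN_shiftNN (x : NN) : consNN (x 0%N) (shiftNN x) = x.
Proof. by apply/funext => -[]. Qed.

Lemma consNN_measurable j : measurable_fun setT (consNN j).
Proof.
by apply: NN_measurable_fun => -[|i]; [right; exists j|left; exists i].
Qed.

Section fibers.
Context {d : measure_display} {Omega : measurableType d} {R : realType}.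
Context {P : probability Omega R}.
Variable S : randomTMC P.
Implicit Types (w : Omega) (x y : NN).

Lemma Xfib_shift w x : Xfib S w x -> Xfib S (theta S w) (shiftNN x).
Proof. by move=> xX i; have := xX i.+1; rewrite -!iterSr. Qed.

Lemma Xfib_iter_shift n w x :
  Xfib S w x -> Xfib S (iter n (theta S) w) (iter n shiftNN x).
Proof. by move=> xX; elim: n => [//|n IH] /=; exact: Xfib_shift. Qed.

Lemma Xfib_consNN w j x : Xfib S w (consNN j x) <->
  [/\ W1 S w j, alpha S w j (x 0%N) & Xfib S (theta S w) x].
Proof.
split=> [jx|[wj jx0 xX] [|i] /=].
  have [? _ ?] := jx 0%N; split => //.
  by have := Xfib_shift jx; rewrite shiftNN_consNN.
  by split => //; have [] := xX 0%N.
by have := xX i; rewrite -!iterSr.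
Qed.

Lemma Xfib_consNN_head w j x y : x 0%N = y 0%N -> Xfib S (theta S w) y ->
  Xfib S w (consNN j x) -> Xfib S w (consNN j y).
Proof.
by move=> xy yX /Xfib_consNN[wj ajx _]; apply/Xfib_consNN; rewrite -xy.
Qed.

End fibers.

(** * One step of the Ruelle operator on bounded functions *)

Section transfer_step.
Context {d : measure_display} {Omega : measurableType d} {R : realType}.
Context {P : probability Omega R}.
Variable S : randomTMC P.
Variable phi : Omega -> NN -> R.
Implicit Types (w : Omega) (x y : NN) (f g : NN -> R).

Definition bounded_on w (M : R) f := forall x, Xfib S w x -> 0 <= f x <= M.

(** The weight 0 on inadmissible letters turns the sum over preimages into a series over all
    letters, with an index set that does not depend on [x]. *)
Definition branch_weight w (j : nat) x : R :=
  if `[< Xfib S w (consNN j x) >] then expR (phi w (consNN j x)) else 0.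

(* The values of [f] are only meaningful on the fibre over [w], those of
   [transfer w f] on the fibre over [theta w]. *)
Definition transfer w f : NN -> R :=
  fun x => fine (ruelle S phi w (fun y => (f y)%:E) x).

Lemma branch_weight_ge0 w j x : 0 <= branch_weight w j x.
Proof. by rewrite /branch_weight; case: asboolP => // _; exact: expR_ge0. Qed.

Lemma branch_weightT w j x : Xfib S w (consNN j x) ->
  branch_weight w j x = expR (phi w (consNN j x)).
Proof. by move=> jx; rewrite /branch_weight asboolT. Qed.

Lemma branch_weightF w j x : ~ Xfib S w (consNN j x) -> branch_weight w j x = 0.
Proof. by move=> jx; rewrite /branch_weight asboolF. Qed.

Lemma branch_weight_mul_ge0 w M j x f : bounded_on w M f ->
  0 <= branch_weight w j x * f (consNN j x).
Proof.
move=> fM; have [jx|jx] := pselect (Xfib S w (consNN j x)).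
  by rewrite mulr_ge0 ?branch_weight_ge0//; have /andP[] := fM _ jx.
by rewrite branch_weightF ?mul0r.
Qed.

Lemma ruelleE w (g : NN -> \bar R) x :
  (forall y, Xfib S w y -> (0 <= g y)%E) ->
  (ruelle S phi w g x =
   \sum_(j <oo) (branch_weight w j x)%:E * g (consNN j x))%E.
Proof.
move=> g0; rewrite nneseries_esumT; last first.
  move=> j; have [jx|jx] := pselect (Xfib S w (consNN j x)).
    by rewrite mule_ge0 ?lee_fin ?branch_weight_ge0// g0.
  by rewrite branch_weightF ?mul0e.
rewrite /ruelle; set A := [set y | _].
have -> : A = (fun j => consNN j x) @` [set j | Xfib S w (consNN j x)].
  apply/seteqP; split => [y [yX <-]|_ [j jx <-]] /=.
    by exists (y 0%N); rewrite /= consNN_shiftNN.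
  by rewrite /A /= shiftNN_consNN.
rewrite esum_image; last by move=> i j _ _ /(congr1 (fun x : NN => x 0%N)).
rewrite esum_mkcond; apply: eq_esum => j _.
case: ifPn => [|/negP]; rewrite inE => jx; first by rewrite branch_weightT.
by rewrite branch_weightF ?mul0e.
Qed.

Lemma ruelle_ge0 w (g : NN -> \bar R) x :
  (forall y, Xfib S w y -> (0 <= g y)%E) -> (0 <= ruelle S phi w g x)%E.
Proof.
move=> g0; rewrite /ruelle; apply: esum_ge0 => y [yX _].
by rewrite mule_ge0 ?lee_fin ?expR_ge0// g0.
Qed.

Variable w : Omega.
Hypothesis ruelle1 :
  forall x, Xfib S (theta S w) x -> ruelle S phi w (cst 1%E) x = 1%E.

Lemma branch_weight_sum x : Xfib S (theta S w) x ->
  (\sum_(j <oo) (branch_weight w j x)%:E = 1)%E.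
Proof.
move=> xX; rewrite -(ruelle1 xX) ruelleE//.
by apply: eq_eseriesr => j _; rewrite mule1.
Qed.

Lemma ruelle_transfer M f x : bounded_on w M f -> Xfib S (theta S w) x ->
  ruelle S phi w (fun y => (f y)%:E) x = (transfer w f x)%:E.
Proof.
move=> fM xX; rewrite /transfer fineK// fin_real//.
have f0 y : Xfib S w y -> (0 <= (f y)%:E)%E by move/fM => /andP[].
rewrite (lt_le_trans (ltNyr 0))/=; last exact: ruelle_ge0.
rewrite ruelleE// (@le_lt_trans _ _ (M%:E))%E ?ltry//.
rewrite -[leRHS]mule1 -(branch_weight_sum xX) -nneseriesZl; last first.
  by move=> j _; rewrite lee_fin branch_weight_ge0.
apply: lee_nneseries => j _; first by rewrite lee_fin (branch_weight_mul_ge0 _ _ fM).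
have [jx|jx] := pselect (Xfib S w (consNN j x)).
  by rewrite muleC lee_fin ler_wpM2r ?branch_weight_ge0//; have /andP[] := fM _ jx.
by rewrite branch_weightF// mul0e mule0.
Qed.

Lemma transferE M f x : bounded_on w M f -> Xfib S (theta S w) x ->
  ((transfer w f x)%:E =
   \sum_(j <oo) (branch_weight w j x * f (consNN j x))%:E)%E.
Proof.
move=> fM xX; rewrite -(ruelle_transfer fM xX) ruelleE//.
by move=> y /fM/andP[].
Qed.

(** Points with the same first letter have the same admissible preimage letters, so the two series
    are compared term by term. *)
Lemma le_transfer_scale M M' (K : R) f g x y :
  bounded_on w M f -> bounded_on w M' g -> 0 <= K ->
  Xfib S (theta S w) x -> Xfib S (theta S w) y -> x 0%N = y 0%N ->
  (forall j, Xfib S w (consNN j x) -> Xfib S w (consNN j y) ->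
     expR (phi w (consNN j x)) * f (consNN j x) <=
     K * (expR (phi w (consNN j y)) * g (consNN j y))) ->
  transfer w f x <= K * transfer w g y.
Proof.
move=> fM gM K0 xX yX xy H.
rewrite -lee_fin EFinM (transferE fM xX) (transferE gM yX) -nneseriesZl; last first.
  by move=> j _; rewrite lee_fin (branch_weight_mul_ge0 _ _ gM).
apply: lee_nneseries => j _; first by rewrite lee_fin (branch_weight_mul_ge0 _ _ fM).
have [jx|jx] := pselect (Xfib S w (consNN j x)); last first.
  by rewrite branch_weightF// mul0r lee_fin mulr_ge0// (branch_weight_mul_ge0 _ _ gM).
have jy := Xfib_consNN_head xy yX jx.
by rewrite !branch_weightT// lee_fin; exact: H.
Qed.

Lemma le_transfer M M' f g x : bounded_on w M f -> bounded_on w M' g ->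
  (forall y, Xfib S w y -> f y <= g y) -> Xfib S (theta S w) x ->
  transfer w f x <= transfer w g x.
Proof.
move=> fM gM fg xX; rewrite -[leRHS]mul1r; apply: le_transfer_scale => //.
- exact: fM.
- exact: gM.
by move=> j jx _; rewrite mul1r ler_wpM2l ?expR_ge0// fg.
Qed.

Lemma bounded_on_cst c : 0 <= c -> bounded_on w c (cst c).
Proof. by move=> c0 x _; rewrite c0 lexx. Qed.

Lemma transfer_cst c x : 0 <= c -> Xfib S (theta S w) x ->
  transfer w (cst c) x = c.
Proof.
move=> c0 xX; apply: EFin_inj; rewrite (transferE (bounded_on_cst c0) xX).
rewrite -[RHS]mule1 -(branch_weight_sum xX) -nneseriesZl; last first.
  by move=> j _; rewrite lee_fin branch_weight_ge0.
by apply: eq_eseriesr => j _; rewrite mulrC EFinM.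
Qed.

Lemma bounded_on_transfer M f : bounded_on w M f ->
  bounded_on (theta S w) M (transfer w f).
Proof.
move=> fM x xX; apply/andP; split.
  by rewrite fine_ge0// ruelle_ge0// => y /fM/andP[].
(* The weights over [x] sum to 1, so [x] has a preimage in the fibre over [w], where
   [0 <= f <= M]. *)
have M0 : 0 <= M.
  have [j jx] : exists j, Xfib S w (consNN j x).
    apply: contrapT => /forallNP nX; have := branch_weight_sum xX.
    rewrite eseries0; first by move=> /eqP; rewrite eqe eq_sym oner_eq0.
    by move=> j _ _; rewrite branch_weightF.
  by have /andP[/le_trans] := fM _ jx; exact.
rewrite -[leRHS](transfer_cst M0 xX); apply: (le_transfer fM) => //.
- exact: bounded_on_cst.
- by move=> y /fM/andP[].
Qed.

Lemma bounded_onD M M' f g : bounded_on w M f -> bounded_on w M' g ->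
  bounded_on w (M + M') (f \+ g).
Proof.
move=> fM gM x xX; have /andP[? ?] := fM _ xX; have /andP[? ?] := gM _ xX.
by rewrite addr_ge0//= lerD.
Qed.

Lemma transferD M M' f g x : bounded_on w M f -> bounded_on w M' g ->
  Xfib S (theta S w) x ->
  transfer w (f \+ g) x = transfer w f x + transfer w g x.
Proof.
move=> fM gM xX; apply: EFin_inj.
rewrite EFinD (transferE fM xX) (transferE gM xX).
rewrite (transferE (bounded_onD fM gM) xX) -nneseriesD.
- by apply: eq_eseriesr => j _; rewrite mulrDr EFinD.
- by move=> j _ _; rewrite lee_fin (branch_weight_mul_ge0 _ _ fM).
- by move=> j _ _; rewrite lee_fin (branch_weight_mul_ge0 _ _ gM).
Qed.

Lemma transfer_branch M f x : bounded_on w M f -> Xfib S w x ->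
  expR (phi w x) * f x <= transfer w f (shiftNN x).
Proof.
move=> fM xX; have sxX := Xfib_shift xX; rewrite -lee_fin (transferE fM sxX).
apply: le_trans (nneseries_lim_ge (x 0%N).+1 _); last first.
  by move=> j _ _; rewrite lee_fin (branch_weight_mul_ge0 _ _ fM).
rewrite big_nat_recr//= consNN_shiftNN branch_weightT ?consNN_shiftNN//.
rewrite leeDr// sume_ge0// => j _; rewrite lee_fin.
exact: (branch_weight_mul_ge0 _ _ fM).
Qed.

End transfer_step.

(** By convexity the exponential lies below its chord between 0 and [u]. With [s = r ^+ k] this
    makes distortion bounds linear in [r ^+ k]. *)
Lemma expR_mul_le (R : realType) (s u : R) : 0 <= s <= 1 -> expR (s * u) <= 1 + s * (expR u - 1).
Proof.
move=> /andP[s0 s1].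
have := convex_expR (Itv01 s0 s1) (u : R^o) (0 : R^o).
by rewrite !convRE /= expR0 mulr0 addr0 mulr1 /unstable.onem => /le_trans; apply; lra.
Qed.

(** * Iterates of the operator: distortion and loss of oscillation *)

Section transfer_iterates.
Context {d : measure_display} {Omega : measurableType d} {R : realType}.
Context {P : probability Omega R}.
Variable S : randomTMC P.
Variables (phi : Omega -> NN -> R) (r : R) (kappa b : Omega -> R).
Variable G : set Omega.
Implicit Types (w : Omega) (x y z : NN) (f g : NN -> R).

Local Notation "'th^' n" := (iter n (theta S)) (at level 2, n at level 1).
Local Notation X := (Xfib S).

Hypothesis G_theta : forall w, G w -> G (theta S w).
Hypothesis G_ruelle1 : forall w, G w ->
  forall x, X (theta S w) x -> ruelle S phi w (cst 1%E) x = 1%E.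

Fixpoint transfern n w f : NN -> R :=
  if n is n'.+1 then transfer S phi (th^ n' w) (transfern n' w f) else f.

Lemma G_iter n w : G w -> G (th^ n w).
Proof. by move=> Gw; elim: n => [//|n IH]; exact: G_theta. Qed.

Lemma transfernD n m w f :
  transfern (n + m) w f = transfern m (th^ n w) (transfern n w f).
Proof.
elim: m => [|m IH]; first by rewrite addn0.
by rewrite addnS /= IH addnC iterD.
Qed.

Lemma bounded_on_transfern n w M f : G w -> bounded_on S w M f ->
  bounded_on S (th^ n w) M (transfern n w f).
Proof.
move=> Gw fM; elim: n => [//|n IH] /=; apply: bounded_on_transfer => //.
exact/G_ruelle1/G_iter.
Qed.

Lemma le_transfern n w M M' f g x : G w ->
  bounded_on S w M f -> bounded_on S w M' g ->
  (forall y, X w y -> f y <= g y) -> X (th^ n w) x ->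
  transfern n w f x <= transfern n w g x.
Proof.
move=> Gw fM gM fg; elim: n x => [|n IH] x xX /=; first exact: fg.
have Gn := G_iter n Gw.
apply: (@le_transfer _ _ _ _ _ _ _ (G_ruelle1 Gn) M M') => //;
  exact: bounded_on_transfern.
Qed.

Lemma eq_transfern n w M M' f g x : G w ->
  bounded_on S w M f -> bounded_on S w M' g ->
  (forall y, X w y -> f y = g y) -> X (th^ n w) x ->
  transfern n w f x = transfern n w g x.
Proof.
move=> Gw fM gM fg xX; apply/eqP; rewrite eq_le.
rewrite (@le_transfern n w M M')//; last by move=> y yX; rewrite fg.
by rewrite (@le_transfern n w M' M)// => y yX; rewrite fg.
Qed.

Lemma transfern_cst n w c x : G w -> 0 <= c -> X (th^ n w) x ->
  transfern n w (cst c) x = c.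
Proof.
move=> Gw c0; elim: n x => [//|n IH] x xX /=; have Gn := G_iter n Gw.
have bc := bounded_on_cst (S := S) (w := w) c0.
rewrite -[RHS](transfer_cst (G_ruelle1 Gn) c0 xX); apply/eqP; rewrite eq_le.
have b1 : bounded_on S (th^ n w) c (transfern n w (cst c)).
  exact: bounded_on_transfern.
have b2 := bounded_on_cst (S := S) (w := th^ n w) c0.
rewrite (@le_transfer _ _ _ _ _ _ _ (G_ruelle1 Gn) c c)//=; last first.
  by move=> y yX; rewrite IH.
rewrite (@le_transfer _ _ _ _ _ _ _ (G_ruelle1 Gn) c c)//=.
by move=> y yX; rewrite IH.
Qed.

Lemma transfern_add n w M M' f g x : G w ->
  bounded_on S w M f -> bounded_on S w M' g -> X (th^ n w) x ->
  transfern n w (f \+ g) x = transfern n w f x + transfern n w g x.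
Proof.
move=> Gw fM gM; elim: n x => [//|n IH] x xX /=; have Gn := G_iter n Gw.
have fMn := bounded_on_transfern (n := n) Gw fM.
have gMn := bounded_on_transfern (n := n) Gw gM.
have fgMn := bounded_on_transfern (n := n) Gw (bounded_onD fM gM).
rewrite -(transferD (G_ruelle1 Gn) fMn gMn xX); apply/eqP; rewrite eq_le.
rewrite (@le_transfer _ _ _ _ _ _ _ (G_ruelle1 Gn) (M + M') (M + M'))//=.
- rewrite (@le_transfer _ _ _ _ _ _ _ (G_ruelle1 Gn) (M + M') (M + M'))//=.
    exact: bounded_onD.
  by move=> y yX; rewrite IH.
- exact: bounded_onD.
- by move=> y yX; rewrite IH.
Qed.

Lemma transfern_branch n w M f z : G w -> bounded_on S w M f -> X w z ->
  expR (birkhoff S phi n w z) * f z <= transfern n w f (iter n shiftNN z).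
Proof.
move=> Gw fM zX; elim: n => [|n IH] /=.
  by rewrite /birkhoff big_ord0 expR0 mul1r.
rewrite /birkhoff big_ord_recr/= expRD mulrAC mulrC.
apply: le_trans; last first.
  apply: (transfer_branch (G_ruelle1 (G_iter n Gw))).
    exact: bounded_on_transfern Gw fM.
  exact: Xfib_iter_shift.
by rewrite ler_wpM2l ?expR_ge0.
Qed.

Hypothesis r_gt0 : 0 < r.
Hypothesis r_lt1 : r < 1.
Hypothesis b_ge0 : forall w, 0 <= b w.
(** Here [b] stands for the logarithm of [B_]; the relation is the shift of its defining series by
    one step. *)
Hypothesis b_theta : forall w, G w -> b (theta S w) = r * (b w + kappa w).
Hypothesis phi_variation : forall w, G w -> forall n x y, (2 <= n)%N ->
  X w x -> X w y -> (forall i, (i < n)%N -> x i = y i) ->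
  phi w x <= phi w y + kappa w * r ^+ n.

Lemma consNN_agree j k x y : (forall i, (i < k)%N -> x i = y i) ->
  forall i, (i < k.+1)%N -> consNN j x i = consNN j y i.
Proof. by move=> xy [|i] //=; exact: xy. Qed.

(** Induction on [n]: one step back lengthens the agreement to [k.+1 >= 2] letters. The errors
    [r ^+ k.+1 * b] of the earlier steps and [r ^+ k.+1 * kappa] of the last one add up to
    [r ^+ k * b] at the next base point. Two functions are allowed so that a truncation can be
    compared with the original. *)
Lemma transfern_distortion n w M M' f g k x y : G w ->
  bounded_on S w M f -> bounded_on S w M' g ->
  (forall z z', X w z -> X w z' ->
     (forall i, (i < n + k)%N -> z i = z' i) -> f z <= g z') ->
  (0 < k)%N -> X (th^ n w) x -> X (th^ n w) y ->
  (forall i, (i < k)%N -> x i = y i) ->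
  transfern n w f x <= expR (r ^+ k * b (th^ n w)) * transfern n w g y.
Proof.
move=> Gw fM gM; elim: n k x y => [|n IH] k x y fg k0 xX yX xy /=.
  have fgxy : f x <= g y by apply: fg.
  apply: (le_trans fgxy); rewrite ler_peMl//; first by have /andP[] := gM _ yX.
  by rewrite -expR0 ler_expR mulr_ge0 ?exprn_ge0// ltW.
have Gn := G_iter n Gw.
have fMn := bounded_on_transfern (n := n) Gw fM.
have gMn := bounded_on_transfern (n := n) Gw gM.
apply: (@le_transfer_scale _ _ _ _ _ _ _ (G_ruelle1 Gn) M M') => //.
  exact: xy.
move=> j jx jy; rewrite b_theta// [r ^+ k * (r * _)]mulrA -exprSr mulrDr expRD.
have H1 : transfern n w f (consNN j x) <=
    expR (r ^+ k.+1 * b (th^ n w)) * transfern n w g (consNN j y).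
  apply: IH => //; last exact: consNN_agree.
  by move=> z z' zX z'X zz'; apply: fg => // i ink; rewrite zz'// addnS.
have H2 : phi (th^ n w) (consNN j x) <=
    r ^+ k.+1 * kappa (th^ n w) + phi (th^ n w) (consNN j y).
  rewrite addrC [_ * kappa _]mulrC; apply: phi_variation => //.
  exact: consNN_agree.
rewrite (le_trans (ler_wpM2l (expR_ge0 _) H1))//.
have g0 : 0 <= transfern n w g (consNN j y) by have /andP[] := gMn _ jy.
have -> : expR (r ^+ k.+1 * b (th^ n w)) * expR (r ^+ k.+1 * kappa (th^ n w)) *
   (expR (phi (th^ n w) (consNN j y)) * transfern n w g (consNN j y)) =
   (expR (r ^+ k.+1 * kappa (th^ n w) + phi (th^ n w) (consNN j y))) *
   (expR (r ^+ k.+1 * b (th^ n w)) * transfern n w g (consNN j y)).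
  by rewrite expRD; ring.
by rewrite ler_wpM2r ?ler_expR// mulr_ge0 ?expR_ge0.
Qed.

Lemma transfern_bounds n w s N f : G w -> 0 <= s -> 0 <= N ->
  (forall x, X w x -> s <= f x <= s + N) ->
  forall x, X (th^ n w) x -> s <= transfern n w f x <= s + N.
Proof.
move=> Gw s0 N0 fs x xX.
have fb : bounded_on S w (s + N) f.
  by move=> z /fs /andP[sf ->]; rewrite (le_trans s0 sf).
apply/andP; split; last by have /andP[] := bounded_on_transfern (n := n) Gw fb xX.
rewrite -[leLHS](transfern_cst Gw s0 xX).
by apply: (le_transfern Gw (bounded_on_cst s0) fb) => // y /fs /andP[].
Qed.

(* The constant [2 * expR (b w)] is such that the estimate reproduces itself
   under the iterates while [N] shrinks by the factor [1 - C / (2 * B)]. *)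
Record oscillation_le w (N : R) f : Prop := {
  osc_bounds : exists2 s, 0 <= s & forall x, X w x -> s <= f x <= s + N;
  osc_holder : forall k x y, (0 < k)%N -> X w x -> X w y ->
    (forall i, (i < k)%N -> x i = y i) ->
    f x - f y <= 2 * expR (b w) * r ^+ k * N }.

(* The coupling step: [f - s - V] is dominated by [f - s] at nearby points,
   so that the bounded distortion of the iterates applies. *)
Lemma transfern_coupling n k w N f x y : G w -> 0 <= N -> oscillation_le w N f ->
  (0 < k)%N -> X (th^ n w) x -> X (th^ n w) y ->
  (forall i, (i < k)%N -> x i = y i) ->
  4 * expR (b w) * r ^+ n <= 1 ->
  exists s, [/\ 0 <= s,
    forall z, X (th^ n w) z -> s <= transfern n w f z <= s + N
    & transfern n w f x - s - r ^+ k * N / 2 <=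
      expR (r ^+ k * b (th^ n w)) * (transfern n w f y - s)].
Proof.
move=> Gw N0 [[s s0 fs] fh] k0 xX yX xy rn; exists s.
(* The variation of [f] at depth [n + k], the agreement reached by [n] steps back from [k] letters.
   The smallness of [r ^+ n] makes it at most half of [r ^+ k * N]. *)
pose V := 2 * expR (b w) * r ^+ (n + k) * N.
have V0 : 0 <= V by rewrite !mulr_ge0 ?expR_ge0 ?exprn_ge0// ltW.
have VN : V <= r ^+ k * N / 2.
  have rk0 : 0 <= r ^+ k * N by rewrite mulr_ge0 ?exprn_ge0// ltW.
  rewrite /V exprD; have := ler_wpM2r rk0 rn; lra.
pose g := fun z => f z - s.
(* The truncation keeps [h] nonnegative, as monotonicity of the operator demands, and [h z <= g z']
   persists because [g >= 0]. *)
pose h := fun z => Num.max (g z - V) 0.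
have gN : bounded_on S w N g.
  by move=> z zX; have := fs _ zX; rewrite /g => /andP[? ?]; apply/andP; split; lra.
have hN : bounded_on S w N h.
  move=> z zX; have /andP[g0 gN'] := gN _ zX.
  by rewrite /h le_max lexx orbT ge_max N0 andbT/=; lra.
have sb := bounded_on_cst (S := S) (w := w) s0.
have Vb := bounded_on_cst (S := S) (w := w) V0.
have fb : bounded_on S w (s + N) f.
  by move=> z /fs /andP[sf ->]; rewrite (le_trans s0 sf).
have TfE z : X (th^ n w) z -> transfern n w f z = s + transfern n w g z.
  move=> zX; rewrite -[s in RHS](transfern_cst Gw s0 zX) -(transfern_add Gw sb gN zX).
  apply: (eq_transfern Gw fb (bounded_onD sb gN)) => // u _.
  by rewrite /g/=; lra.
have Tgh : transfern n w g x <= transfern n w h x + V.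
  rewrite -[V in leRHS](transfern_cst Gw V0 xX) -(transfern_add Gw hN Vb xX).
  apply: (le_transfern Gw gN (bounded_onD hN Vb)) => // u _ /=.
  by rewrite -lerBlDr /h le_max lexx.
have Thg : transfern n w h x <= expR (r ^+ k * b (th^ n w)) * transfern n w g y.
  apply: (transfern_distortion Gw hN gN) => // z z' zX z'X zz'.
  have /andP[g0 _] := gN _ z'X.
  rewrite /h ge_max g0 andbT /g.
  have := fh _ _ _ _ zX z'X zz'; rewrite addn_gt0 k0 orbT => /(_ isT).
  rewrite /V; lra.
split=> // [z zX|].
  have /andP[] := bounded_on_transfern (n := n) Gw gN zX.
  by rewrite TfE// => ? ?; apply/andP; split; lra.
rewrite (TfE _ xX) (TfE _ yX).
rewrite [s + transfern n w g y]addrC addrK [s + transfern n w g x]addrC addrK.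
by rewrite lerBlDr (le_trans Tgh)// lerD.
Qed.

(** Write [u], [v] for the two values. Coupling at depth 1 gives [u - s - N / 2 <= Bs * (v - s)];
    adding [(Bs - 1) * (u - s) <= (Bs - 1) * N] yields [Bs * (u - v) <= (Bs - 1 / 2) * N]. *)
Lemma transfern_close n w N (Bs : R) f x y : G w -> 0 <= N ->
  oscillation_le w N f -> 4 * expR (b w) * r ^+ n <= 1 ->
  1 <= Bs -> expR (b (th^ n w)) <= Bs ->
  X (th^ n w) x -> X (th^ n w) y -> x 0%N = y 0%N ->
  transfern n w f x - transfern n w f y <= (1 - (2 * Bs)^-1) * N.
Proof.
move=> Gw N0 oscf rn B1 bB xX yX xy.
have [|s [s0 fs]] := transfern_coupling (k := 1) Gw N0 oscf isT xX yX _ rn.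
  by case.
have /andP[] := fs _ xX; have /andP[] := fs _ yX.
move: (transfern n w f x) (transfern n w f y) => u v sv vN su uN.
have eB : expR (r ^+ 1 * b (th^ n w)) <= Bs.
  apply: le_trans bB; rewrite ler_expR expr1 ler_piMl//; exact: ltW.
have B0 : 0 < Bs by lra.
move=> H0; rewrite expr1 in eB H0.
have H : u - s - N / 2 <= Bs * (v - s).
  apply: (@le_trans _ _ (u - s - r * N / 2)).
    by rewrite lerB// ler_wpM2r// ler_piMl// ltW.
  by rewrite (le_trans H0)// ler_wpM2r// subr_ge0.
rewrite -(ler_pM2l B0) mulrBr.
have -> : Bs * ((1 - (2 * Bs)^-1) * N) = Bs * N - N / 2.
  by field; rewrite gt_eqF.
have K : (Bs - 1) * (u - s) <= (Bs - 1) * N by rewrite ler_wpM2l//; lra.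
move: K H; lra.
Qed.

(** Both [F1 = T^n f - s] and [F2 = s + N - T^n f] are nonnegative, so their images under [m] more
    steps are at least [Cs] times their values at the chosen preimages [z'] of [y] and [z] of [x].
    Hence the difference at [x] and [y] is at most [N - Cs * (F1 z' + F2 z)], and the sum in
    brackets is at least [N / (2 * Bs)] because [z] and [z'] share their first letter. *)
Lemma transfern_mix n m w N (Bs Cs : R) (o : nat) f :
  G w -> 0 <= N -> oscillation_le w N f -> 4 * expR (b w) * r ^+ n <= 1 ->
  1 <= Bs -> expR (b (th^ n w)) <= Bs -> 0 < Cs ->
  (forall y, X (th^ (n + m) w) y -> exists z, [/\ X (th^ n w) z,
     z 0%N = o, iter m shiftNN z = y
     & Cs <= expR (birkhoff S phi m (th^ n w) z)]) ->
  oscillation_le (th^ (n + m) w) ((1 - Cs / (2 * Bs)) * N)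
    (transfern (n + m) w f).
Proof.
move=> Gw N0 oscf rn B1 bB C0 branch.
have Gn := G_iter n Gw.
have mnE : th^ (n + m) w = th^ m (th^ n w) by rewrite addnC iterD.
have [s s0 fs] := osc_bounds oscf.
have fb : bounded_on S w (s + N) f.
  by move=> z /fs /andP[sf ->]; rewrite (le_trans s0 sf).
have B0 : 0 < Bs by lra.
(* One branch weighs no more than all branches together, whose total is 1. *)
have C1 y : X (th^ (n + m) w) y -> Cs <= 1.
  move=> yX; have [z [zX _ zy /le_trans]] := branch _ yX; apply.
  have := transfern_branch m Gn (bounded_on_cst (S := S) (w := th^ n w) ler01) zX.
  by rewrite mulr1 zy transfern_cst ?ler01// -mnE.
pose t := 1 - Cs / (2 * Bs).
(* This is where the factor 2 in [osc_holder] pays: the bound [r ^+ k * N * e] obtained below fits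
   under [2 * e * r ^+ k * (t * N)]. *)
have t12 : Cs <= 1 -> 1 <= 2 * t.
  move=> C1'; suff : Cs / Bs <= 1 by rewrite /t invfM; lra.
  by rewrite ler_pdivrMr// mul1r (le_trans C1').
have sN0 : 0 <= s + N by lra.
have Tfb := bounded_on_transfern (n := n) Gw fb.
have Tlow := transfern_bounds (n := n) Gw s0 N0 fs.
have branchle (F : NN -> R) y z : X (th^ n w) z ->
    bounded_on S (th^ n w) N F -> iter m shiftNN z = y -> 
    Cs <= expR (birkhoff S phi m (th^ n w) z) ->
    Cs * F z <= transfern m (th^ n w) F y.
  move=> zX FN zy Cz; rewrite -zy.
  apply: le_trans (transfern_branch m Gn FN zX).
  by rewrite ler_wpM2r//; have /andP[] := FN _ zX.
pose F1 z := transfern n w f z - s.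
pose F2 z := s + N - transfern n w f z.
have F1b : bounded_on S (th^ n w) N F1.
  by move=> z /Tlow /andP[? ?]; rewrite /F1; apply/andP; split; lra.
have F2b : bounded_on S (th^ n w) N F2.
  by move=> z /Tlow /andP[? ?]; rewrite /F2; apply/andP; split; lra.
have sb := bounded_on_cst (S := S) (w := th^ n w) s0.
have sNb := bounded_on_cst (S := S) (w := th^ n w) sN0.
have TF1 y : X (th^ (n + m) w) y ->
    transfern (n + m) w f y = s + transfern m (th^ n w) F1 y.
  rewrite mnE => yX.
  rewrite transfernD -[s in RHS](transfern_cst Gn s0 yX).
  rewrite -(transfern_add Gn sb F1b yX).
  apply: (eq_transfern Gn Tfb (bounded_onD sb F1b)) => // u _.
  by rewrite /F1/=; lra.
have TF2 y : X (th^ (n + m) w) y ->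
    transfern (n + m) w f y + transfern m (th^ n w) F2 y = s + N.
  rewrite mnE => yX.
  rewrite transfernD -(transfern_add Gn Tfb F2b yX).
  rewrite -[RHS](transfern_cst Gn sN0 yX).
  apply: (eq_transfern Gn (bounded_onD Tfb F2b) sNb) => // u _.
  by rewrite /F2/=; lra.
have diff x y : X (th^ (n + m) w) x -> X (th^ (n + m) w) y ->
    transfern (n + m) w f x - transfern (n + m) w f y <= t * N.
  move=> xX yX.
  have [z [zX zo zx zC]] := branch _ xX.
  have [z' [z'X z'o z'y z'C]] := branch _ yX.
  have := branchle _ _ _ zX F2b zx zC.
  have := branchle _ _ _ z'X F1b z'y z'C.
  have := TF1 _ yX; have := TF2 _ xX.
  have : transfern n w f z - transfern n w f z' <= (1 - (2 * Bs)^-1) * N.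
    by apply: (transfern_close Gw N0 oscf) => //; rewrite zo z'o.
  rewrite /F1 /F2 -(ler_pM2l C0) /t.
  lra.
split.
  (* Over an empty fibre any lower bound serves; otherwise the infimum of the iterate is taken. *)
  have [[x0 x0X]|nX] := pselect (exists x, X (th^ (n + m) w) x); last first.
    by exists 0 => // x xX; exfalso; apply: nX; exists x.
  pose A := transfern (n + m) w f @` X (th^ (n + m) w).
  have lbA : lbound A 0.
    move=> _ [x xX <-].
    by have /andP[] := bounded_on_transfern (n := n + m) Gw fb xX.
  have A0 : A !=set0 by exists (transfern (n + m) w f x0); exists x0.
  exists (inf A); first exact: lb_le_inf.
  move=> x xX; apply/andP; split.
    by apply: ge_inf; [exists 0|exists x].
  rewrite -lerBlDr; apply: lb_le_inf => // _ [y yX <-].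
  by rewrite lerBlDr addrC -lerBlDr; exact: diff.
move=> k x y k0 xX yX xy.
have rk0 : 0 <= r ^+ k by rewrite exprn_ge0// ltW.
have rk1 : r ^+ k <= 1 by rewrite exprn_ile1// ltW.
(* For the local variations the coupling step is applied to all [n + m] steps at once, now at depth
   [k]. *)
have rnm : 4 * expR (b w) * r ^+ (n + m) <= 1.
  apply: le_trans rn; rewrite ler_wpM2l ?mulr_ge0 ?expR_ge0// exprD ler_piMr//.
    by rewrite exprn_ge0// ltW.
  by rewrite exprn_ile1// ltW.
have [s' [s'0 fs' H]] := transfern_coupling Gw N0 oscf k0 xX yX xy rnm.
have /andP[] := fs' _ yX; move: H.
have := C1 _ xX.
move: (transfern _ _ _ x) (transfern _ _ _ y) => u v C1' H s'v vN.
have E : expR (r ^+ k * b (th^ (n + m) w)) <= 1 + r ^+ k * (expR (b (th^ (n + m) w)) - 1).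
  by apply: expR_mul_le; rewrite rk0.
have e1 : 1 <= expR (b (th^ (n + m) w)) by rewrite -expR0 ler_expR.
move: e1 E H; move: (expR (b _)) (expR (_ * b _)) => e e' e1 E H.
have v0 : 0 <= v - s' by lra.
have H1 : u - s' - r ^+ k * N / 2 <= (1 + r ^+ k * (e - 1)) * (v - s').
  by rewrite (le_trans H)// ler_wpM2r.
have H2 : r ^+ k * (e - 1) * (v - s') <= r ^+ k * (e - 1) * N.
  by rewrite ler_wpM2l ?mulr_ge0//; lra.
have H3 : u - v <= r ^+ k * N * e.
  have : 0 <= r ^+ k * N by rewrite mulr_ge0.
  by move: H1 H2; lra.
apply: (le_trans H3).
have -> : 2 * e * r ^+ k * ((1 - Cs / (2 * Bs)) * N) = (r ^+ k * N * e) * (2 * t).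
  by rewrite /t; ring.
by rewrite ler_peMr ?t12// !mulr_ge0//; lra.
Qed.

(** * Contraction along the return sequence *)

Variables (Obp : set Omega) (I : set nat) (o : Omega -> nat) (Bstar Cstar : R).
Local Notation star := (Omega_star S Obp I o phi r kappa Bstar Cstar).
Local Notation mm := (m_ S Obp I o).
Local Notation nn := (n_ S Obp I o phi r kappa Bstar Cstar).
Local Notation ll := (l_ S Obp I o phi r kappa Bstar Cstar).

Hypothesis Bstar_ge1 : 1 <= Bstar.
Hypothesis Cstar_gt0 : 0 < Cstar.
Hypothesis n_star : forall w, G w -> star (th^ (nn w) w).
Hypothesis n_small : forall w, G w -> 4 * expR (b w) * r ^+ (nn w) <= 1.
Hypothesis star_b : forall w, G w -> star w -> expR (b w) <= Bstar.
Hypothesis star_branch : forall w, G w -> star w ->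
  forall y, X (th^ (mm w) w) y -> exists z, [/\ X w z, z 0%N = o w,
    iter (mm w) shiftNN z = y & Cstar <= expR (birkhoff S phi (mm w) w z)].

Local Notation t := (1 - Cstar / (2 * Bstar)).

(** A contraction consists of a wait [nn] followed by a coupling time [mm], whereas [ll] ends with a
    wait. The induction therefore follows the time [p] at which that last wait begins. *)
Lemma oscillation_along_l k w N f : G w -> 0 <= N -> 0 <= t ->
  oscillation_le w N f -> exists p,
  [/\ ll k w = (p + nn (th^ p w))%N
    & oscillation_le (th^ p w) (t ^+ k * N) (transfern p w f)].
Proof.
move=> Gw N0 t0 oscf; elim: k => [|k [p [lE oscp]]].
  by exists 0%N; rewrite expr0 mul1r.
have Gp := G_iter p Gw.
have Gl := G_iter (ll k w) Gw.
have lpE : th^ (ll k w) w = th^ (nn (th^ p w)) (th^ p w).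
  by rewrite lE addnC iterD.
exists (ll k w + mm (th^ (ll k w) w))%N; split => //=.
set m := mm _; rewrite exprS -mulrA.
have -> : th^ (ll k w + m) w = th^ (nn (th^ p w) + m) (th^ p w).
  by rewrite lE -iterD; congr iter; lia.
have -> : transfern (ll k w + m) w f =
    transfern (nn (th^ p w) + m) (th^ p w) (transfern p w f).
  by rewrite lE -addnA transfernD.
apply: (transfern_mix (o := o (th^ (ll k w) w))) => //.
- by rewrite mulr_ge0 ?exprn_ge0.
- exact: n_small.
- by apply: star_b; [exact: G_iter | exact: n_star].
move=> y yX; rewrite -lpE; apply: star_branch => //.
  by rewrite lpE; exact: n_star.
by rewrite -/m lpE -iterD addnC.
Qed.

(** The last wait, from [p] to [ll k w], does not enlarge the range of the function. *)
Lemma transfern_l_oscillation k w N f x y : G w -> 0 <= N -> 0 <= t ->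
  oscillation_le w N f -> X (th^ (ll k w) w) x -> X (th^ (ll k w) w) y ->
  transfern (ll k w) w f x - transfern (ll k w) w f y <= t ^+ k * N.
Proof.
move=> Gw N0 t0 oscf; have [p [-> [[s s0 fs] _]]] := oscillation_along_l k Gw N0 t0 oscf.
rewrite transfernD addnC iterD => xX yX.
have N'0 : 0 <= t ^+ k * N by rewrite mulr_ge0 ?exprn_ge0.
have Gp := G_iter p Gw.
have /andP[] := transfern_bounds Gp s0 N'0 fs xX.
have /andP[] := transfern_bounds Gp s0 N'0 fs yX.
lra.
Qed.

End transfer_iterates.

(** * Measurability of the fibres, the potential and the operator *)

Lemma NN_coordinate2_measurable (i : nat) (Q : nat -> nat -> Prop) :
  measurable [set x : NN | Q (x i) (x i.+1)].
Proof.
have -> : [set x : NN | Q (x i) (x i.+1)] =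
    \bigcup_j \bigcup_(k in [set k | Q j k])
      ([set x : NN | x i = j] `&` [set x : NN | x i.+1 = k]).
  apply/seteqP; split => [x Qx|x [j _ [k jk [/= xj xk]]]].
  by exists (x i) => //; exists (x i.+1).
by rewrite /= xj xk.
apply: bigcup_measurable => j _; apply: bigcup_measurable => k _.
by apply: measurableI; exact: NN_coordinate_measurable.
Qed.

Section measurability.
Context {d : measure_display} {Omega : measurableType d} {R : realType}.
Context {P : probability Omega R}.
Variable S : randomTMC P.
Variable phi : Omega -> NN -> R.
Implicit Types (w : Omega) (x y z : NN) (f : NN -> R).

Local Notation "'th^' n" := (iter n (theta S)) (at level 2, n at level 1).

Lemma iter_theta_measurable n : measurable_fun setT (th^ n).
Proof.
elim: n => [|n IH]; first exact: measurable_id.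
have -> : th^ n.+1 = theta S \o th^ n by [].
by apply: measurableT_comp => //; exact: theta_measurable (base_automorphism S).
Qed.

Lemma iter_thetaV_measurable n : measurable_fun setT (iter n (thetaV S)).
Proof.
elim: n => [|n IH]; first exact: measurable_id.
have -> : iter n.+1 (thetaV S) = thetaV S \o iter n (thetaV S) by [].
by apply: measurableT_comp => //; exact: thetaV_measurable (base_automorphism S).
Qed.

Lemma Xfib_measurable w : measurable (Xfib S w).
Proof.
have -> : Xfib S w = \bigcap_i [set x | [/\ W1 S (th^ i w) (x i),
    W1 S (th^ i.+1 w) (x i.+1) & alpha S (th^ i w) (x i) (x i.+1)]].
  by apply/seteqP; split => [x xX i _|x xX i]; exact: xX.
apply: bigcap_measurable; first by exists 0%N.
move=> i _; exact: (NN_coordinate2_measurable i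
  (fun j k => [/\ W1 S (th^ i w) j, W1 S (th^ i.+1 w) k & alpha S (th^ i w) j k])).
Qed.

Lemma Xtot_measurable : measurable (Xtot S).
Proof.
have -> : Xtot S = \bigcap_i \bigcup_j \bigcup_k
    ((th^ i @^-1` [set w | [/\ W1 S w j, W1 S (theta S w) k & alpha S w j k]]) `*`
     ([set x : NN | x i = j] `&` [set x : NN | x i.+1 = k])).
  apply/seteqP; split => [[w x] wx i _|[w x] wx i].
    by exists (x i) => //; exists (x i.+1) => //; split => //=; exact: wx.
  by have [j _ [k _ [/= ? [-> ->]]]] := wx i I.
apply: bigcap_measurable; first by exists 0%N.
move=> i _; apply: bigcup_measurable => j _; apply: bigcup_measurable => k _.
apply: measurableX; last by apply: measurableI; exact: NN_coordinate_measurable.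
rewrite -[X in measurable X]setTI; apply: iter_theta_measurable => //.
exact: alpha_measurable.
Qed.

Hypothesis phi_measurable :
  measurable_fun (Xtot S) (fun p : Omega * NN => phi p.1 p.2).

Lemma potential_measurable w : measurable_fun (Xfib S w) (phi w).
Proof.
have -> : phi w = (fun p : Omega * NN => phi p.1 p.2) \o pair w by [].
apply: (@measurable_comp _ _ _ _ _ _ (Xtot S)) => //.
- exact: Xtot_measurable.
- by move=> _ [x xX <-].
- exact: measurable_funTS (pair1_measurable w).
Qed.

Lemma transfer_measurable w M f :
  (forall x, Xfib S (theta S w) x -> ruelle S phi w (cst 1%E) x = 1%E) ->
  bounded_on S w M f -> measurable_fun (Xfib S w) f ->
  measurable_fun (Xfib S (theta S w)) (transfer S phi w f).
Proof.
move=> L1 fM mf; apply/measurable_EFinP.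
have mX := Xfib_measurable w.
(* Extending by 0 gives a function measurable on the whole space, which can be composed with every
   [consNN j], admissible or not. *)
pose F := (fun y => expR (phi w y) * f y) \_ (Xfib S w).
have mF : measurable_fun setT F.
  apply/(measurable_restrictT _ mX); apply: measurable_funM => //.
  by apply: measurableT_comp => //; exact: potential_measurable.
apply: (eq_measurable_fun (fun x => \sum_(j <oo) (F (consNN j x))%:E)%E).
  move=> x; rewrite inE => xX; rewrite /= (transferE L1 fM xX).
  apply: eq_eseriesr => j _; rewrite /F patchE; congr EFin.
  case: ifPn => [|/negP]; rewrite inE => jx; first by rewrite branch_weightT.
  by rewrite branch_weightF// mul0r.
apply: ge0_emeasurable_sum => [j x xX _|j _].
  rewrite lee_fin /F patchE; case: ifPn => //; rewrite inE => jx.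
  by rewrite mulr_ge0 ?expR_ge0//; have /andP[] := fM _ jx.
apply/measurable_EFinP; apply: measurable_funTS.
by apply: measurableT_comp => //; exact: consNN_measurable.
Qed.

End measurability.

(** Applied to the masses of the letters of [I], some of which may vanish when a letter is absent
    from the alphabet. *)
Lemma finite_set_lower_bound (R : realType) (I : set nat) (F : nat -> R) :
  finite_set I ->
  exists2 eta : R, 0 < eta & forall i, I i -> 0 < F i -> eta <= F i.
Proof.
move=> /finite_seqP[s ->]; elim: s => [|i s [eta eta0 IH]]; first by exists 1.
have [Fi|Fi] := ltP 0 (F i); last first.
  exists eta => // j /=; rewrite inE => /predU1P[->|/IH]//.
  by move=> /lt_le_trans/(_ Fi); rewrite ltxx.
exists (Num.min eta (F i)); first by rewrite lt_min eta0.
move=> j /=; rewrite inE => /predU1P[->|js] Fj; first by rewrite ge_min lexx orbT.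
by rewrite ge_min IH.
Qed.

(** * Masses of words as integrals of iterates *)

Section invariant_measures.
Context {d : measure_display} {Omega : measurableType d} {R : realType}.
Context {P : probability Omega R}.
Variable S : randomTMC P.
Variables (phi : Omega -> NN -> R).
Variable G : set Omega.
Variable nu : Omega -> probability NN R.
Implicit Types (w : Omega) (x y z : NN) (f g : NN -> R).

Local Notation "'th^' n" := (iter n (theta S)) (at level 2, n at level 1).
Local Notation X := (Xfib S).
Local Notation TN := (transfern S phi).

Hypothesis phi_measurable :
  measurable_fun (Xtot S) (fun p : Omega * NN => phi p.1 p.2).
Hypothesis G_theta : forall w, G w -> G (theta S w).
Hypothesis G_ruelle1 : forall w, G w ->
  forall x, X (theta S w) x -> ruelle S phi w (cst 1%E) x = 1%E.
Hypothesis G_dual : forall w, G w ->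
  is_ruelle_dual S phi w (nu (theta S w)) (nu w).
Hypothesis G_support : forall w, G w -> msupport (nu w) = X w.

Lemma Xfib_full w : G w -> nu w (X w) = 1%E.
Proof.
by move=> Gw; apply: msupport_full; [exact: Xfib_measurable|exact: G_support].
Qed.

Lemma measure_Xfib w (B : set NN) : G w -> measurable B ->
  nu w (X w `&` B) = nu w B.
Proof.
move=> Gw mB; have mX := Xfib_measurable S w.
rewrite setIC (measureDI (nu w) mB mX) [X in (X + _)%E](_ : _ = 0%E) ?add0e//.
apply/eqP; rewrite eq_le measure_ge0 andbT.
apply: (@le_trans _ _ (nu w (~` X w))).
  by apply: le_measure; rewrite ?inE; [exact: measurableD|exact: measurableC|move=> x []].
by rewrite probability_setC// Xfib_full// subee.
Qed.

Lemma transfern_measurable n w M f : G w -> bounded_on S w M f ->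
  measurable_fun (X w) f -> measurable_fun (X (th^ n w)) (TN n w f).
Proof.
move=> Gw fM mf; elim: n => [//|n IH] /=.
have Gn := G_iter G_theta n Gw.
apply: (transfer_measurable phi_measurable (G_ruelle1 Gn)) => //.
exact: (bounded_on_transfern G_theta G_ruelle1 Gw fM).
Qed.

(** Duality is tested against [f] cut off to the preimage of [B]. The cut-off is the same at all
    preimages of a point, so it leaves the Ruelle sum as the indicator of [B]. *)
Lemma integral_transfer w M f (B : set NN) : G w -> bounded_on S w M f ->
  measurable_fun (X w) f -> measurable B ->
  (\int[nu w]_(x in X w `&` shiftNN @^-1` B) (f x)%:E =
   \int[nu (theta S w)]_(x in X (theta S w) `&` B) (transfer S phi w f x)%:E)%E.
Proof.
move=> Gw fM mf mB; rewrite !integral_mkcondr.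
have mB' : measurable (shiftNN @^-1` B).
  by rewrite -[X in measurable X]setTI; exact: shiftNN_measurable.
have mXw := Xfib_measurable S w.
have f0 x : X w x -> (0 <= ((fun x => (f x)%:E) \_ (shiftNN @^-1` B)) x)%E.
  move=> xX; rewrite patchE; case: ifP => // _.
  by rewrite lee_fin; have /andP[] := fM _ xX.
rewrite (G_dual Gw)//; last first.
  apply/measurable_restrict => //.
  apply: measurable_funS ((measurable_EFinP _ _).2 mf) => //; exact: subIsetl.
apply: eq_integral => x; rewrite inE => xX.
have := ruelle_transfer (G_ruelle1 Gw) fM xX.
rewrite /ruelle !patchE; case: ifPn => [|/negP]; rewrite inE => xB H.
  apply: etrans H; apply: eq_esum => y [_ yx].
  by rewrite patchE ifT// inE /= yx.
rewrite [RHS](_ : _ = 0%E)// esum1// => y [_ yx].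
rewrite patchE ifF ?mule0//.
by apply/negbTE/negP; rewrite inE /= yx.
Qed.

Lemma integral_transfern n w M f (B : set NN) : G w -> bounded_on S w M f ->
  measurable_fun (X w) f -> measurable B ->
  (\int[nu w]_(x in X w `&` iter n shiftNN @^-1` B) (f x)%:E =
   \int[nu (th^ n w)]_(x in X (th^ n w) `&` B) (TN n w f x)%:E)%E.
Proof.
move=> Gw fM mf; elim: n B => [//|n IH] B mB.
have mB' : measurable (shiftNN @^-1` B).
  by rewrite -[X in measurable X]setTI; exact: shiftNN_measurable.
rewrite (IH _ mB') (@integral_transfer _ M _ _ (G_iter G_theta n Gw) _ _ mB)//.
- exact: (bounded_on_transfern G_theta G_ruelle1 Gw fM).
- exact: (transfern_measurable Gw fM).
Qed.

Section words.
Variables (w : Omega) (a : seq nat) (n : nat).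
Hypothesis Gw : G w.

Let f : NN -> R := \1_(cylinder a).

Lemma indic_bounded_on : bounded_on S w 1 f.
Proof. by move=> x _; rewrite /f indicE ler0n lern1; case: (_ \in _). Qed.

Let mf : measurable_fun (X w) f.
Proof. by apply: measurable_funTS; apply: measurable_indic; exact: cylinder_measurable. Qed.

Lemma word_measureE (B : set NN) : measurable B ->
  (nu w (cylinder a `&` iter n shiftNN @^-1` B) =
   \int[nu (th^ n w)]_(x in X (th^ n w) `&` B) (TN n w f x)%:E)%E.
Proof.
move=> mB; rewrite -(integral_transfern n Gw indic_bounded_on mf mB).
have mB' : measurable (iter n shiftNN @^-1` B).
  by rewrite -[X in measurable X]setTI; exact: iter_shiftNN_measurable.
have mX := Xfib_measurable S w; have ma := cylinder_measurable a.
rewrite integral_indic//; last exact: measurableI.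
rewrite [X in _ = nu w X]setICA.
by rewrite measure_Xfib//; exact: measurableI.
Qed.

Let Tf_ge0 x : X (th^ n w) x -> 0 <= TN n w f x.
Proof.
by move=> xX; have /andP[] := bounded_on_transfern G_theta G_ruelle1 Gw indic_bounded_on xX.
Qed.

Let mTf : measurable_fun (X (th^ n w)) (TN n w f).
Proof. exact: (transfern_measurable Gw indic_bounded_on). Qed.

Lemma word_measure_le (B : set NN) (c : R) : measurable B -> 0 <= c ->
  (forall x, X (th^ n w) x -> B x -> TN n w f x <= c) ->
  (nu w (cylinder a `&` iter n shiftNN @^-1` B) <= c%:E * nu (th^ n w) B)%E.
Proof.
move=> mB c0 H; rewrite word_measureE//.
have mX := Xfib_measurable S (th^ n w).
rewrite -(measure_Xfib (G_iter G_theta n Gw) mB) -integral_cst//; last exact: measurableI.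
apply: ge0_le_integral => //.
- exact: measurableI.
- by move=> x [xX _]; rewrite lee_fin Tf_ge0.
- by apply: measurable_funS ((measurable_EFinP _ _).2 mTf) => //; exact: subIsetl.
- by move=> x [xX xB]; rewrite lee_fin H.
Qed.

Lemma word_measure_ge (B : set NN) (c : R) : measurable B -> 0 <= c ->
  (forall x, X (th^ n w) x -> B x -> c <= TN n w f x) ->
  (c%:E * nu (th^ n w) B <= nu w (cylinder a `&` iter n shiftNN @^-1` B))%E.
Proof.
move=> mB c0 H; rewrite word_measureE//.
have mX := Xfib_measurable S (th^ n w).
rewrite -(measure_Xfib (G_iter G_theta n Gw) mB) -integral_cst//; last exact: measurableI.
apply: ge0_le_integral => //.
- exact: measurableI.
- by apply: measurable_funS ((measurable_EFinP _ _).2 mTf) => //; exact: subIsetl.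
- by move=> x [xX xB]; rewrite lee_fin H.
Qed.

End words.

Lemma transfer_only w M f (c : nat) x : G w -> bounded_on S w M f ->
  (forall z, X w z -> z 0%N <> c -> f z = 0) -> X (theta S w) x ->
  transfer S phi w f x = branch_weight S phi w c x * f (consNN c x).
Proof.
move=> Gw fM fc xX; apply: EFin_inj; rewrite (transferE (G_ruelle1 Gw) fM xX).
rewrite (nneseriesD1 (n := c))//; last first.
  by move=> j _; rewrite lee_fin (branch_weight_mul_ge0 _ _ _ fM).
rewrite eseries0 ?adde0// => j _ /= /eqP jc.
have [jx|jx] := pselect (X w (consNN j x)); last by rewrite branch_weightF ?mul0r.
by rewrite fc ?mulr0.
Qed.

Lemma transfern_eq0 n w M f (B : set NN) x : G w -> bounded_on S w M f ->
  (forall z, X w z -> ~ B (iter n shiftNN z) -> f z = 0) ->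
  X (th^ n w) x -> ~ B x -> TN n w f x = 0.
Proof.
move=> Gw fM; elim: n B x => [|n IH] B x fB xX xB /=; first exact: fB.
have Gn := G_iter G_theta n Gw.
have Tb := bounded_on_transfern G_theta G_ruelle1 (n := n) Gw fM.
apply: EFin_inj; rewrite (transferE (G_ruelle1 Gn) Tb xX).
rewrite eseries0// => j _ _.
have [jx|jx] := pselect (X (th^ n w) (consNN j x)); last by rewrite branch_weightF ?mul0r.
by rewrite (IH (shiftNN @^-1` B))//= ?mulr0.
Qed.

Variables (r : R) (kappa b : Omega -> R).
Hypothesis r_gt0 : 0 < r.
Hypothesis r_lt1 : r < 1.
Hypothesis b_ge0 : forall w, 0 <= b w.
Hypothesis b_theta : forall w, G w -> b (theta S w) = r * (b w + kappa w).
Hypothesis phi_variation : forall w, G w -> forall n x y, (2 <= n)%N ->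
  X w x -> X w y -> (forall i, (i < n)%N -> x i = y i) ->
  phi w x <= phi w y + kappa w * r ^+ n.

(** Points that agree on [n + k] letters are either both in the cylinder of [a] or both outside
    it. *)
Lemma indic_transfern_distortion n a v k x y : G v -> (size a <= n + k)%N ->
  (0 < k)%N -> X (th^ n v) x -> X (th^ n v) y ->
  (forall i, (i < k)%N -> x i = y i) ->
  TN n v \1_(cylinder a) x <=
  expR (r ^+ k * b (th^ n v)) * TN n v \1_(cylinder a) y.
Proof.
move=> Gv ank k0 xX yX xy.
apply: (transfern_distortion G_theta G_ruelle1 r_gt0 b_ge0 b_theta phi_variation
  Gv (indic_bounded_on a) (indic_bounded_on a)) => // z z' zX z'X zz'.
suff -> : \1_(cylinder a) z = \1_(cylinder a) z' :> R by [].
rewrite !indicE; congr (_%:R); congr nat_of_bool; apply/idP/idP;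
  rewrite !inE => za i ia; have := za i ia; rewrite zz'// (leq_trans ia)//.
Qed.

Lemma cylinder1_head x j : x 0%N = j -> cylinder [:: j] x.
Proof. by move=> xj [|]. Qed.

Lemma cylinder1_measure_gt0 w x : G w -> X w x ->
  (0 < nu w (cylinder [:: x 0%N]))%E.
Proof.
move=> Gw xX; apply: (@msupport_cylinder_gt0 _ _ x); last exact: cylinder1_head.
by rewrite G_support.
Qed.

(** Up to a factor [M] from distortion, the value of the iterate at [x] is a lower bound for it on
    the 1-cylinder of [x]. Integrating there and using the mass bound costs the second factor [M];
    the mass of that 1-cylinder cancels, being positive by the support condition. The local
    variations then follow from distortion and convexity. *)
Lemma word_oscillation v a M : G v -> 1 <= M -> expR (b (th^ (size a) v)) <= M ->
  (forall j, (nu v (cylinder a `&` iter (size a) shiftNN @^-1` cylinder [:: j]) <=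
     M%:E * nu v (cylinder a) * nu (th^ (size a) v) (cylinder [:: j]))%E) ->
  oscillation_le S r b (th^ (size a) v) (M * M * fine (nu v (cylinder a)))
    (TN (size a) v \1_(cylinder a)).
Proof.
move=> Gv M1 bM aj; set k := size a; set w := th^ k v.
have Gw : G w by exact: (G_iter G_theta).
have ma := cylinder_measurable a.
have fin (u : Omega) (B : set NN) : measurable B -> nu u B \is a fin_num.
  by move=> mB; exact: fin_num_measure.
set q := fine _; have q0 : 0 <= q by rewrite fine_ge0.
have M0 : 0 <= M by rewrite (le_trans ler01).
have MMq0 : 0 <= M * M * q by rewrite !mulr_ge0.
have Tb := bounded_on_transfern G_theta G_ruelle1 (n := k) Gv (indic_bounded_on a).
have le_Mq x : X w x -> TN k v \1_(cylinder a) x <= M * M * q.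
  move=> xX; have /andP[T0 _] := Tb _ xX.
  have mj := cylinder_measurable [:: x 0%N].
  have c0 : 0 <= M^-1 * TN k v \1_(cylinder a) x by rewrite mulr_ge0 ?invr_ge0.
  have H : forall y, X w y -> cylinder [:: x 0%N] y ->
      M^-1 * TN k v \1_(cylinder a) x <= TN k v \1_(cylinder a) y.
    move=> y yX /(_ 0%N isT) /= yx.
    have /andP[Ty0 _] := Tb _ yX.
    rewrite ler_pdivrMl ?(lt_le_trans ltr01)//.
    apply: le_trans (indic_transfern_distortion (k := 1) Gv _ _ xX yX _) _ => //.
    - by rewrite leq_addr.
    - by case.
    rewrite ler_wpM2r// (le_trans _ bM)// ler_expR expr1 ler_piMl//.
    exact: ltW.
  have := le_trans (word_measure_ge Gv mj c0 H) (aj _).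
  rewrite -[nu v (cylinder a)]fineK ?fin// -/q -[nu w (cylinder _)]fineK ?fin// -!EFinM lee_fin.
  rewrite ler_pM2r ?fine_gt0//; last by rewrite cylinder1_measure_gt0//= ltey_eq fin//.
  by rewrite ler_pdivrMl ?(lt_le_trans ltr01)// mulrA.
split.
  by exists 0 => // x xX; rewrite add0r le_Mq// andbT; have /andP[] := Tb _ xX.
move=> j x y j0 xX yX xy.
have /andP[Ty0 _] := Tb _ yX.
have rj0 : 0 <= r ^+ j by rewrite exprn_ge0// ltW.
have rj1 : r ^+ j <= 1 by rewrite exprn_ile1// ltW.
have rj01 : 0 <= r ^+ j <= 1 by rewrite rj0.
have H1 : TN k v \1_(cylinder a) x <=
    expR (r ^+ j * b w) * TN k v \1_(cylinder a) y.
  by apply: indic_transfern_distortion => //; rewrite leq_addr.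
have H2 := ler_wpM2r Ty0 (expR_mul_le (b w) rj01).
have e1 : 1 <= expR (b w) by rewrite -expR0 ler_expR.
have H3 := le_Mq _ yX.
move: H1 H2 H3 Ty0 e1.
move: (TN k v _ x) (TN k v _ y) (expR (b w)) (expR (_ * _)) (M * M * q) MMq0.
move=> X1 Y1 e e' Q Q0 H1 H2 H3 Y0 e1.
have H4 : r ^+ j * (e - 1) * Y1 <= r ^+ j * (e - 1) * Q.
  by rewrite ler_wpM2l ?mulr_ge0//; lra.
have H5 : 0 <= r ^+ j * Q by rewrite mulr_ge0.
have H6 : r ^+ j * Q <= r ^+ j * Q * e by rewrite ler_peMr.
have -> : 2 * e * r ^+ j * Q = 2 * (r ^+ j * Q * e) by ring.
have H7 : r ^+ j * (e - 1) * Q = r ^+ j * Q * e - r ^+ j * Q by ring.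
have H8 : (1 + r ^+ j * (e - 1)) * Y1 = Y1 + r ^+ j * (e - 1) * Y1 by ring.
lra.
Qed.

(** The iterate has integral [q] against a probability measure. Its value at any point, lowered by
    [delta], is a lower bound for it everywhere, hence at most [q]. *)
Lemma word_mixing_le v a n (delta : R) (A : set NN) : G v -> 0 <= delta ->
  measurable A ->
  (forall x y, X (th^ n v) x -> X (th^ n v) y ->
    TN n v \1_(cylinder a) x - TN n v \1_(cylinder a) y <= delta) ->
  (nu v (cylinder a `&` iter n shiftNN @^-1` A) <=
   (fine (nu v (cylinder a)) + delta)%:E * nu (th^ n v) A)%E.
Proof.
move=> Gv d0 mA H.
have fin (u : Omega) (B : set NN) : measurable B -> nu u B \is a fin_num.
  by move=> mB; exact: fin_num_measure.
set q := fine _; have q0 : 0 <= q by rewrite fine_ge0.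
apply: (word_measure_le Gv) => //; first by rewrite addr_ge0.
move=> x xX _; rewrite -lerBlDr.
have [|c0] := ltP (TN n v \1_(cylinder a) x - delta) 0.
  by move=> /ltW /le_trans; exact.
have := word_measure_ge (n := n) (a := a) Gv measurableT c0.
rewrite preimage_setT setIT.
rewrite -[nu v _]fineK ?fin//; last exact: cylinder_measurable.
rewrite -/q probability_setT mule1 lee_fin; apply.
by move=> y yX _; rewrite lerBlDr -lerBlDl; exact: H.
Qed.

(* The words of length [k.+1] ending over [u] put comparable masses on all
   continuations: the last letter branches into [I], and the last potential is
   controlled by its first variation. *)
Lemma word_mixing_bound u (I : set nat) (V : R) : G u ->
  (forall x y, X u x -> X u y -> x 0%N = y 0%N -> phi u x <= phi u y + V) ->
  finite_set I ->
  (forall c, W1 S u c -> exists y : NN,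
     [/\ X (theta S u) y, I (y 0%N) & alpha S u c (y 0%N)]) ->
  exists2 K : R, 0 <= K & forall v a k, G v -> th^ k v = u -> size a = k.+1 ->
    forall j, (nu v (cylinder a `&` iter k.+1 shiftNN @^-1` cylinder [:: j]) <=
      K%:E * nu v (cylinder a) * nu (theta S u) (cylinder [:: j]))%E.
Proof.
move=> Gu uV finI uI.
have fin (w : Omega) (B : set NN) : measurable B -> nu w B \is a fin_num.
  by move=> mB; exact: fin_num_measure.
have Gw := G_theta Gu; set w := theta S u in Gw uI *.
pose F i := fine (nu w (cylinder [:: i])).
have [eta eta0 etaI] : exists2 eta : R, 0 < eta & forall i, I i -> 0 < F i -> eta <= F i.
  exact: finite_set_lower_bound.
(* The factor [expR V] pays for the last potential, the other one for the distortion of the first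
   [k] steps at depth 1. *)
pose K0 := expR V * expR (r * b u).
have K00 : 0 < K0 by rewrite mulr_gt0 ?expR_gt0.
exists (K0 / eta); first by rewrite divr_ge0// ltW.
move=> v a k Gv vu sa j.
have wE : th^ k.+1 v = w by rewrite /= vu.
have ma := cylinder_measurable a.
set q := fine (nu v (cylinder a)).
have Tb := bounded_on_transfern G_theta G_ruelle1 (n := k) Gv (indic_bounded_on a).
have Tb1 := bounded_on_transfern G_theta G_ruelle1 (n := k.+1) Gv (indic_bounded_on a).
rewrite vu in Tb; rewrite wE in Tb1.
have le_q x : X w x -> TN k.+1 v \1_(cylinder a) x <= K0 / eta * q.
  move=> xX; set c := nth 0%N a k.
  (* After [k] steps only the last letter [c] of [a] remains to be read, so the next step sees the
     single branch [c]. *)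
  have Tc z : X u z -> z 0%N <> c -> TN k v \1_(cylinder a) z = 0.
    move=> zX zc; apply: (transfern_eq0 (B := [set z : NN | z 0%N = c]) Gv
      (indic_bounded_on a)) => //; last by rewrite vu.
    move=> y yX /= yc; rewrite indicE memNset// => /(_ k).
    rewrite sa ltnS leqnn => /(_ isT) ya.
    by apply: yc; rewrite iter_shiftNNE addn0.
  have q0 : 0 <= q by rewrite fine_ge0.
  rewrite /= vu (transfer_only Gu Tb Tc xX).
  have [cx|cx] := pselect (X u (consNN c x)); last first.
    by rewrite branch_weightF// mul0r mulr_ge0// divr_ge0// ltW.
  rewrite branch_weightT//; set h := _ * _.
  have [y [yX Iy cy]] : exists y : NN, [/\ X w y, I (y 0%N) & alpha S u c (y 0%N)].
    by apply: uI; have [] := cx 0%N.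
  (* The branch [c] also exists over every point starting with the letter [y 0] of [I]. The two
     preimages share only the letter [c], which is why the first variation enters. *)
  have lower y' : X w y' -> cylinder [:: y 0%N] y' -> K0^-1 * h <= TN k.+1 v \1_(cylinder a) y'.
    move=> y'X /(_ 0%N isT) /= y'y; rewrite vu.
    have cy' : X u (consNN c y').
      by apply/Xfib_consNN; rewrite y'y; split => //; have [] := cx 0%N.
    have := transfer_branch (G_ruelle1 Gu) Tb cy'.
    rewrite shiftNN_consNN; apply: le_trans.
    rewrite ler_pdivrMl// /h.
    have H1 : TN k v \1_(cylinder a) (consNN c x) <=
        expR (r * b u) * TN k v \1_(cylinder a) (consNN c y').
      rewrite -[r in leRHS]expr1 -[in leRHS]vu.
      apply: indic_transfern_distortion => //; rewrite ?vu//.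
      - by rewrite sa addn1.
      - by case.
    have H2 : expR (phi u (consNN c x)) <= expR V * expR (phi u (consNN c y')).
      by rewrite -expRD ler_expR addrC uV.
    have T0 : 0 <= TN k v \1_(cylinder a) (consNN c x) by have /andP[] := Tb _ cx.
    have := ler_pM (expR_ge0 _) T0 H2 H1.
    by rewrite /K0 !mulrA [_ * _ * expR (r * _)]mulrAC.
  have h0 : 0 <= h by rewrite mulr_ge0 ?expR_ge0//; have /andP[] := Tb _ cx.
  have c0 : 0 <= K0^-1 * h by rewrite mulr_ge0// invr_ge0 ltW.
  have my := cylinder_measurable [:: y 0%N].
  have := word_measure_ge (n := k.+1) (a := a) (B := cylinder [:: y 0%N]) Gv my c0.
  rewrite wE => /(_ lower).
  have sub : (nu v (cylinder a `&` iter k.+1 shiftNN @^-1` cylinder [:: y 0%N]) <=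
      nu v (cylinder a))%E.
    apply: le_measure; rewrite ?inE//.
    apply: measurableI => //; rewrite -[X in measurable X]setTI.
    exact: iter_shiftNN_measurable.
  move=> /le_trans /(_ sub).
  rewrite -[nu v (cylinder a)]fineK ?fin// -/q -[nu w _]fineK ?fin// -EFinM lee_fin -/(F _).
  (* Since [y] lies in the support, its first letter has positive mass, and this mass is then at
     least [eta]. *)
  have Fy : 0 < F (y 0%N).
    rewrite fine_gt0// (cylinder1_measure_gt0 Gw yX)/= ltey_eq fin//.
  move=> H; rewrite mulrAC ler_pdivlMr// -ler_pdivrMl// mulrA.
  by rewrite (le_trans _ H)// ler_wpM2l// etaI.
have -> : (nu v (cylinder a) = q%:E)%E by rewrite /q fineK ?fin.
rewrite -EFinM -wE; apply: (word_measure_le Gv) => //.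
- exact: cylinder_measurable.
- by rewrite mulr_ge0 ?fine_ge0// divr_ge0// ltW.
- by rewrite wE => x xX _; exact: le_q.
Qed.

End invariant_measures.

(** * Least times and lexicographically least words *)

Lemma nat_min_exists (A : set nat) : A !=set0 ->
  exists n, A n /\ forall k, A k -> (n <= k)%N.
Proof.
move=> [n0 An0].
have ex : exists n, `[< A n >] by exists n0; apply/asboolP.
case: (ex_minnP ex) => n /asboolP An nmin; exists n; split => // k Ak.
by apply: nmin; apply/asboolP.
Qed.

Lemma nat_min_mem (A : set nat) : A !=set0 -> A (nat_min A).
Proof. by move=> /nat_min_exists /(xgetPex 0%N) []. Qed.

(** Take the least first letter and recurse on the tails. The common length matters: the words 1,
    01, 001 and so on have no lexicographic minimum. *)
Lemma lex_min_exists n (A : set (seq nat)) : (forall u, A u -> size u = n) ->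
  A !=set0 -> exists u, A u /\
    forall v, A v -> ((u : seqlexi nat) <= (v : seqlexi nat))%O.
Proof.
elim: n A => [|n IH] A sA [u Au].
  exists [::]; have := sA _ Au; by case: u Au.
have [|j [[s Ajs] jmin]] := @nat_min_exists [set j | exists s, A (j :: s)].
  by have := sA _ Au; case: u Au => // j s Au _; exists j, s.
have [s' /sA[]//||v [Ajv vmin]] := IH [set s | A (j :: s)]; first by exists s.
exists (j :: v); split => // -[|i v'] Av; first by have := sA _ Av.
rewrite lexi_cons; have ji : (j <= i)%N by apply: jmin; exists v'.
apply/andP; split => //; apply/implyP => ij.
have ij' : i = j by apply/eqP; rewrite eqn_leq ji andbT.
by apply: vmin; rewrite /= -ij'.
Qed.

Lemma lex_min_mem n (A : set (seq nat)) : (forall u, A u -> size u = n) ->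
  A !=set0 -> A (lex_min A).
Proof. by move=> sA /(lex_min_exists sA) /(xgetPex [::]) []. Qed.

Lemma prepend_cons j u (x : NN) : prepend (j :: u) x = consNN j (prepend u x).
Proof. by apply/funext => -[|i]. Qed.

Lemma prepend_nil (x : NN) : prepend [::] x = x.
Proof. by apply/funext => i; rewrite /prepend subn0. Qed.

Lemma iter_shiftNN_prepend u (x : NN) : iter (size u) shiftNN (prepend u x) = x.
Proof.
elim: u => [|j u IH]; first by rewrite prepend_nil.
by rewrite /= -iterS iterSr prepend_cons shiftNN_consNN.
Qed.

Lemma prepend_cylinder u (x : NN) : cylinder u x ->
  prepend u (iter (size u) shiftNN x) = x.
Proof.
move=> xu; apply/funext => i; rewrite /prepend; case: ifPn => iu.
  by rewrite xu.
by rewrite iter_shiftNNE subnKC// leqNgt.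
Qed.

(** * Admissible words, matrix products and the coupling branch *)

Section admissible_words.
Context {d : measure_display} {Omega : measurableType d} {R : realType}.
Context {P : probability Omega R}.
Variable S : randomTMC P.
Implicit Types (w : Omega) (x y z : NN).

Local Notation "'th^' n" := (iter n (theta S)) (at level 2, n at level 1).
Local Notation X := (Xfib S).

Lemma words_cons w n j u : words S w n.+1 (j :: u) -> words S (theta S w) n u.
Proof.
move=> [/= [sz] wu au]; split => // i ni.
  by have := wu i.+1 ni; rewrite iterSr.
by have := au i.+1 ni; rewrite iterSr.
Qed.

Lemma Xfib_prepend w n u y : words S w n u -> X (th^ n w) y ->
  ((0 < n)%N -> alpha S (th^ n.-1 w) (nth 0%N u n.-1) (y 0%N)) ->
  X w (prepend u y).
Proof.
elim: n w u => [|n IH] w u wu yX ay.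
  by have [/size0nil -> _ _] := wu; rewrite prepend_nil.
case: u wu ay => [[]//|j u wu ay].
have wu' := words_cons wu; have [sz wj aj] := wu.
have uX : X (theta S w) (prepend u y).
  apply: IH => //; first by rewrite -iterSr.
  by case: n wu yX ay wu' sz wj aj => // n wu yX /(_ isT) + _ _ _ _ _ /=; rewrite -iterSr.
rewrite prepend_cons; apply/Xfib_consNN; split => //; first exact: (wj 0%N).
case: u wu {ay aj wj} wu' sz uX (ay isT) (aj 0%N) => [|i u] wu wu' [sz] uX /=.
  by rewrite -sz/= prepend_nil.
by rewrite -sz prepend_cons => _ /(_ isT).
Qed.

Lemma esum_gt0 (A : set nat) (f : nat -> \bar R) :
  (forall i, A i -> (0 <= f i)%E) -> (0 < \esum_(i in A) f i)%E ->
  exists2 i, A i & (0 < f i)%E.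
Proof.
move=> f0 sf; apply: contrapT => H; move: sf; rewrite esum1 ?ltxx// => i Ai.
apply/eqP; rewrite eq_le f0// andbT leNgt; apply/negP => fi.
by apply: H; exists i.
Qed.

Lemma mxprod_ge0 n w i j : (0 <= mxprod S n w i j)%E.
Proof.
elim: n w i => [|n IH] w i /=; first by rewrite lee_fin.
by apply: esum_ge0 => l _; rewrite mule_ge0// lee_fin.
Qed.

Lemma mxprod_gt0_word n w i j : W1 S w i -> (0 < mxprod S n w i j)%E ->
  exists u, [/\ words S w n.+1 u, nth 0%N u 0 = i & nth 0%N u n = j].
Proof.
elim: n w i => [|n IH] w i wi /=.
  rewrite lte_fin ltr0n lt0b => /eqP <-; exists [:: i]; split => //.
  by split => // -[|k].
move=> /esum_gt0[l Wl|l Wl].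
  by rewrite mule_ge0 ?lee_fin// mxprod_ge0.
have [ail|] := boolP (alpha S w i l); last by rewrite mul0e ltxx.
rewrite mul1e => /(IH _ _ Wl)[u [[sz wu au] u0 un]].
exists (i :: u); split => //; split => /=; first by rewrite sz.
  by move=> [|k] //= kn; have := wu k kn; rewrite -iterSr.
move=> [|k] /= kn; first by rewrite u0.
by have := au k kn; rewrite -iterSr.
Qed.

Lemma Xfib_mxprod n w x : X w x -> (1 <= mxprod S n w (x 0%N) (x n))%E.
Proof.
elim: n w x => [|n IH] w x xX /=; first by rewrite eqxx.
have [_ w1 a01] := xX 0%N.
apply: esum_ge; exists [set x 1%N].
  by split; [exact: finite_set1 | move=> _ ->].
rewrite fsbig_set1 a01 mul1e.
exact: (IH _ _ (Xfib_shift xX)).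
Qed.

Lemma Xfib_extend w j :
  (forall n i, W1 S (th^ n w) i ->
     exists l, W1 S (th^ n.+1 w) l /\ alpha S (th^ n w) i l) ->
  W1 S w j -> exists2 x, X w x & x 0%N = j.
Proof.
move=> rows wj.
pose Q n i := [set l | W1 S (th^ n.+1 w) l /\ alpha S (th^ n w) i l].
pose x := fix x n := if n is n'.+1 then xget 0%N (Q n' (x n')) else j.
have xW n : W1 S (th^ n w) (x n).
  elim: n => [//|n IH] /=.
  by have [] := xgetPex 0%N (rows n _ IH).
exists x => // i; split => //.
by have [] := xgetPex 0%N (rows i _ (xW i)).
Qed.

Variables (Obi Obp : set Omega) (I : set nat) (o : Omega -> nat).
Hypothesis hbip : bip S Obi Obp I.

(** Finiteness of [I] gives one mixing time [N0] for all its letters, and recurrence gives a later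
    visit to [Obp]. The visit is taken after [N0.+1] because the matrix product reaches the letter
    at time [n.-1]. *)
Lemma m_mem w :
  (forall j, I j -> exists N : nat, forall n, (N <= n)%N -> W1 S (th^ n w) j ->
     exists x, [/\ X w x, x 0%N = o w & x n = j]) ->
  (forall N, exists2 n, (N <= n)%N & Obp (th^ n w)) ->
  let m := m_ S Obp I o w in
  [/\ (1 <= m)%N, Obp (th^ m w) &
  forall j, (I `&` W1 S (th^ m.-1 w)) j -> (1 <= mxprod S m.-1 w (o w) j)%E].
Proof.
move=> mix rec m; apply: (@nat_min_mem [set n | [/\ (1 <= n)%N, Obp (th^ n w) &
  forall j, (I `&` W1 S (th^ n.-1 w)) j -> (1 <= mxprod S n.-1 w (o w) j)%E]]).
have [N0 HN0] : exists N : nat, forall j, I j -> forall n, (N <= n)%N ->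
    W1 S (th^ n w) j -> exists x, [/\ X w x, x 0%N = o w & x n = j].
  have /finite_seqP[s sE] := bip_finite hbip; rewrite sE in mix *.
  elim: s mix {sE} => [|i s IH] mix; first by exists 0%N.
  have [|N HN] := IH; first by move=> j js; apply: mix; rewrite /= inE js orbT.
  have [N' HN'] := mix i (mem_head _ _).
  exists (maxn N N') => j /=; rewrite inE => /predU1P[-> n|js n].
    by rewrite geq_max => /andP[_]; exact: HN'.
  by rewrite geq_max => /andP[+ _]; exact: HN.
have [n n1 obn] := rec N0.+1; exists n => /=.
split => //; first exact: leq_trans n1.
move=> j [Ij wj]; have [|x [xX <- <-]] := HN0 _ Ij n.-1 _ wj.
  by rewrite -ltnS prednK// (leq_trans _ n1).
exact: Xfib_mxprod.
Qed.

Variables (phi : Omega -> NN -> R) (r : R) (kappa : Omega -> R) (Bstar Cstar : R).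

(** A letter of [I] precedes the first letter of [y], and a positive matrix entry joins [o w] to it.
    So the set of words that defines [u_] is nonempty, its minimum is a genuine member, and the
    point it yields over [y] is one over which [C_] takes its infimum. *)
Lemma C_branch w : W1 S w (o w) ->
  cancel (theta S) (thetaV S) ->
  let m := m_ S Obp I o w in
  [/\ (1 <= m)%N, Obp (th^ m w) &
    forall j, (I `&` W1 S (th^ m.-1 w)) j -> (1 <= mxprod S m.-1 w (o w) j)%E] ->
  (Cstar%:E <= C_ S Obp I o phi w)%E ->
  forall y, X (th^ m w) y -> exists z, [/\ X w z, z 0%N = o w,
    iter m shiftNN z = y & Cstar <= expR (birkhoff S phi m w z)].
Proof.
move=> wo thK m [m1 mbp mI] CC y yX.
have mS : m = m.-1.+1 by rewrite prednK.
have VE : thetaV S (th^ m w) = th^ m.-1 w by rewrite mS/= thK.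
have [w0 _ _] := yX 0%N.
have [b Ib wb] := bip_bp hbip mbp w0; rewrite VE in wb.
have [_ wb0 wb1] := wb.
have [|u [wu u0 ub]] := @mxprod_gt0_word m.-1 w (o w) b wo.
  by rewrite (lt_le_trans _ (mI b _)) ?lte01//; split => //; exact: (wb0 0%N).
rewrite -mS in wu.
pose U := [set u | [/\ words S w m u, nth 0%N u 0 = o w, I (nth 0%N u m.-1)
  & (iter m shiftNN @` cyl S w u) y]].
have Uu : U u.
  have [szu _ _] := wu.
  split => //; first by rewrite ub.
  exists (prepend u y); last by rewrite -szu iter_shiftNN_prepend.
  split; first by apply: (Xfib_prepend wu yX) => _; rewrite ub; exact: (wb1 0%N).
  by move=> i iu; rewrite /prepend iu.
have sU v : U v -> size v = m by move=> [[]].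
have [wv v0 _ [z [zX zv] zy]] := lex_min_mem sU (ex_intro _ u Uu).
rewrite -[lex_min U]/(u_ S Obp I o w y) in wv v0 zv.
have [szv _ _] := wv.
exists z; split => //.
  by rewrite zv ?szv.
rewrite -lee_fin (le_trans CC)//; apply: ereal_inf_lbound; exists y => //.
by rewrite -(prepend_cylinder zv) szv zy.
Qed.

End admissible_words.

(** * Invariant sets and recurrence in the base *)

Section ergodic_base.
Context {d : measure_display} {Omega : measurableType d} {R : realType}.
Variable P : probability Omega R.
Implicit Types (A : set Omega) (Q : Omega -> Prop).

Lemma iter_preimage_measurable (f : Omega -> Omega) n A : measurable_fun setT f ->
  measurable A -> measurable (iter n f @^-1` A).
Proof.
move=> mf; elim: n A => [//|n IH] A mA; apply: (IH (f @^-1` A)).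
by rewrite -[X in measurable X]setTI; exact: mf.
Qed.

Lemma iter_preimage_measure (f : Omega -> Omega) n A : measurable_fun setT f ->
  (forall A, measurable A -> P (f @^-1` A) = P A) ->
  measurable A -> P (iter n f @^-1` A) = P A.
Proof.
move=> mf fP; elim: n A => [//|n IH] A mA; rewrite -(fP A mA).
by apply: (IH (f @^-1` A)); rewrite -[X in measurable X]setTI; exact: mf.
Qed.

Lemma ae_iter (f : Omega -> Omega) Q : measurable_fun setT f ->
  (forall A, measurable A -> P (f @^-1` A) = P A) ->
  {ae P, forall w, Q w} -> {ae P, forall w, forall n, Q (iter n f w)}.
Proof.
move=> mf fP [N [mN N0 QN]]; apply: ae_foralln => n.
exists (iter n f @^-1` N); split.
- exact: iter_preimage_measurable.
- by rewrite -[RHS]N0; exact: iter_preimage_measure.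
- by move=> w /= nQ; exact: QN.
Qed.

Variables theta thetaV : Omega -> Omega.
Hypothesis H : ergodic_automorphism P theta thetaV.

Lemma thetaV_preserving A : measurable A -> P (thetaV @^-1` A) = P A.
Proof.
move=> mA; have mVA : measurable (thetaV @^-1` A).
  by rewrite -[X in measurable X]setTI; exact: thetaV_measurable H _ _ _.
rewrite -(theta_preserving H mVA); congr (P _); apply/funext => w /=.
by rewrite (theta_cancel H).
Qed.

(** The countable intersection of all forward and backward translates. It turns almost sure
    assumptions into pointwise ones that hold along whole orbits. *)
Lemma ae_invariant_set Q : {ae P, forall w, Q w} -> exists G : set Omega,
  [/\ (forall w, G w -> Q w), (forall w, G w -> G (theta w)),
      (forall w, G w -> G (thetaV w)) & {ae P, forall w, G w}].
Proof.
move=> aeQ; exists [set w | forall n, Q (iter n theta w) /\ Q (iter n thetaV w)].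
split=> [w /(_ 0%N) []//|w Qw [|n]|w Qw [|n]|].
- by have [] := Qw 1%N.
- rewrite [iter n.+1 thetaV _]iterSr (theta_cancel H) -iterSr.
  by have [] := Qw n.+2; have [] := Qw n.
- by have [] := Qw 1%N.
- rewrite [iter n.+1 theta _]iterSr (thetaV_cancel H) -iterSr.
  by have [] := Qw n.+2; have [] := Qw n.
have := ae_iter (theta_measurable H) (theta_preserving H) aeQ.
have := ae_iter (thetaV_measurable H) thetaV_preserving aeQ.
by apply: filterS2 => w h1 h2 n; split.
Qed.

(* The set of points that return infinitely often is invariant and at least as
   large as the set itself, hence of full measure by ergodicity. *)
Lemma ae_recurrence A : measurable A -> (0 < P A)%E ->
  {ae P, forall w, forall N, exists2 n, (N <= n)%N & A (iter n theta w)}.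
Proof.
move=> mA A0; pose F n := iter n theta @^-1` A.
pose U n := \bigcup_(k in [set k | (n <= k)%N]) F k.
have mF n : measurable (F n).
  by apply: iter_preimage_measurable => //; exact: theta_measurable H.
have mU n : measurable (U n) by exact: bigcup_measurable.
have mL : measurable (\bigcap_n U n) by exact: bigcapT_measurable.
(* Ergodicity is stated for strictly invariant sets, so equality is proved rather than equality up
   to a null set. *)
have thL : theta @^-1` (\bigcap_n U n) = \bigcap_n U n.
  apply/seteqP; split => [w wU n _|w wU n _].
    have [k /= nk Fk] := wU n I; exists k.+1; first by rewrite /= leqW.
    by rewrite /F /= -iterS iterSr.
  have [[//|k] /= nk Fk] := wU n.+1 I; exists k => //.
  by move: Fk; rewrite /F /= -iterS iterSr.
(* Each [U n] contains the translate [F n], which has the measure of [A]; then continuity from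
   above. *)
have PL : (P A <= P (\bigcap_n U n))%E.
  have U0 : (P (U 0%N) < +oo)%E by rewrite ltey_eq fin_num_measure.
  have Umon : {homo U : n m / (n <= m)%N >-> (m <= n)%O}.
    move=> n m nm; apply/subsetPset => w [k /= mk Fk]; exists k => //=.
    exact: leq_trans mk.
  have cvgU := nonincreasing_cvg_mu U0 mU mL Umon.
  rewrite -(cvg_lim _ cvgU)//; apply: lime_ge.
    by apply/cvg_ex; eexists; exact: cvgU.
  apply: nearW => n /=.
  rewrite -(iter_preimage_measure n (theta_measurable H) (theta_preserving H) mA).
  apply: le_measure; rewrite ?inE; [exact: mF|exact: mU|].
  by move=> w Fw; exists n => /=.
have [L0|L1] := theta_ergodic H mL thL.
  by move: PL; rewrite L0 leNgt A0.
exists (~` (\bigcap_n U n)); split; first exact: measurableC.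
  by rewrite probability_setC// L1 subee.
move=> w /= nrec wU; apply: nrec => N; have [n /= Nn Fn] := wU N I.
by exists n.
Qed.

End ergodic_base.

Lemma measureD_null d (T : measurableType d) (R : realType)
    (nu : {measure set T -> \bar R}) (A N : set T) :
  measurable A -> measurable N -> nu N = 0%E -> nu (A `\` N) = nu A.
Proof.
move=> mA mN N0; rewrite (measureDI nu mA mN) [X in (_ + X)%E](_ : _ = 0%E) ?adde0//.
apply/eqP; rewrite eq_le measure_ge0 andbT -N0.
by apply: le_measure; rewrite ?inE//; exact: measurableI.
Qed.

(** * Regular base points have full measure *)

Section regular_points.
Context {d : measure_display} {Omega : measurableType d} {R : realType}.
Context {P : probability Omega R}.
Variable S : randomTMC P.
Implicit Types (w : Omega) (x y z : NN).

Local Notation "'th^' n" := (iter n (theta S)) (at level 2, n at level 1).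
Local Notation "'thV^' n" := (iter n (thetaV S)) (at level 2, n at level 1).
Local Notation X := (Xfib S).

Let thK : cancel (theta S) (thetaV S).
Proof. exact: theta_cancel (base_automorphism S). Qed.

Let thVK : cancel (thetaV S) (theta S).
Proof. exact: thetaV_cancel (base_automorphism S). Qed.

Lemma iter_thetaVK k : cancel (thV^ k) (th^ k).
Proof. by elim: k => [//|k IH] w; rewrite iterSr [thV^ _ _]/= thVK IH. Qed.

Section holder_sum.
Variables (r : R) (kappa : Omega -> R).
Hypothesis r_gt0 : 0 < r.
Hypothesis kappa_ge0 : forall w, 0 <= kappa w.

Definition holder_sum w : \bar R :=
  (\sum_(1 <= k <oo) (kappa (thV^ k w) * r ^+ k)%:E)%E.

Let term_ge0 w k : (0 <= (kappa (thV^ k w) * r ^+ k)%:E)%E.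
Proof. by rewrite lee_fin mulr_ge0// exprn_ge0// ltW. Qed.

Lemma holder_sum_ge0 w : (0 <= holder_sum w)%E.
Proof. by apply: nneseries_ge0 => k _ _; exact: term_ge0. Qed.

Lemma holder_sum_theta w :
  holder_sum (theta S w) = (r%:E * ((kappa w)%:E + holder_sum w))%E.
Proof.
rewrite /holder_sum -(nneseries_addn 1)//.
transitivity (\sum_(0 <= k <oo) r%:E * (kappa (thV^ k w) * r ^+ k)%:E)%E.
  apply: eq_eseriesr => k _; rewrite addn1 iterSr thK exprS -EFinM.
  by rewrite mulrCA.
rewrite nneseriesZl; last by move=> k _; exact: term_ge0.
by rewrite nneseries_recl//= expr0 mulr1.
Qed.

Lemma holder_sum_measurable : measurable_fun setT kappa ->
  measurable_fun setT holder_sum.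
Proof.
move=> mk; rewrite /holder_sum.
apply: (eq_measurable_fun (fun w => \sum_(0 <= k <oo)
    (kappa (thV^ (k + 1) w) * r ^+ (k + 1))%:E)%E).
  by move=> w _; rewrite -(nneseries_addn 1).
apply: ge0_emeasurable_sum => // k _; apply/measurable_EFinP.
apply: measurable_funM => //.
by apply: measurableT_comp => //; exact: iter_thetaV_measurable.
Qed.

End holder_sum.

Lemma ae_successor : {ae P, forall w, forall i, W1 S w i ->
  exists l, W1 S (theta S w) l /\ alpha S w i l}.
Proof.
apply: filterS (alpha_rows S) => w H i wi.
have [l _ |l Wl] := esum_gt0 _ (H i wi); first by rewrite lee_fin.
rewrite lte_fin ltr0n lt0b => ail; by exists l.
Qed.

(** Letters whose alphabet event is null are discarded at the cost of a null set. For any other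
    letter almost every occurrence extends to an infinite admissible path. Mixing, which concerns
    globally admissible letters, thus applies to the letters met along an orbit. *)
Lemma ae_letter_global :
  {ae P, forall w, forall i, W1 S w i -> global_words S 1 [:: i]}.
Proof.
have [G [Grow Gth _ aeG]] := ae_invariant_set (base_automorphism S) ae_successor.
apply: ae_foralln => i.
have [Wi0|Wi0] := eqVneq (P [set w | W1 S w i]) 0%E.
  exists [set w | W1 S w i]; split => //; first exact: W1_measurable.
  by move=> w /= /not_implyP[].
apply: nearW => w _; split => //.
have [N [mN N0 GN]] := aeG.
exists ([set w | W1 S w i] `\` N); split.
- by apply: measurableD => //; exact: W1_measurable.
- move=> v [vi vN]; have Gv : G v by apply: contrapT => nG; apply: vN; exact: GN.
  have [|x xX x0] := Xfib_extend _ vi.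
    by move=> n j; apply: Grow; elim: n => [//|n IH]; exact: Gth.
  by exists x; split => // -[|k].
rewrite measureD_null//; last exact: W1_measurable.
by rewrite lt0e Wi0 measure_ge0.
Qed.

(** All almost sure properties used at a single base point, gathered so that one invariant set
    serves for all of them. *)
Record regular (phi : Omega -> NN -> R) (r : R) (kappa : Omega -> R)
    (Obi Obp star : set Omega) (mu : Omega -> set NN -> \bar R)
    (o : Omega -> nat) w : Prop := {
  reg_ruelle1 : forall x, X (theta S w) x -> ruelle S phi w (cst 1%E) x = 1%E;
  reg_dual : is_ruelle_dual S phi w (mu (theta S w)) (mu w);
  reg_probability : exists nu : probability NN R, mu w = nu;
  reg_support : msupport (mu w) = X w;
  reg_variation : forall n, (2 <= n)%N ->
    (Defs.variation S phi n w <= (kappa w * r ^+ n)%:E)%E;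
  reg_variation1 : (theta S @^-1` (Obi `|` Obp)) w ->
    (Defs.variation S phi 1 w < +oo)%E;
  reg_o : W1 S w (o w);
  reg_successor : forall i, W1 S w i ->
    exists l, W1 S (theta S w) l /\ alpha S w i l;
  reg_Obp : forall N, exists2 n, (N <= n)%N & Obp (th^ n w);
  reg_star : forall N, exists2 n, (N <= n)%N & star (th^ n w);
  reg_global : forall i, W1 S w i -> global_words S 1 [:: i];
  reg_mixing : forall i j, global_words S 1 [:: i] -> global_words S 1 [:: j] ->
    exists N : nat, forall n, (N <= n)%N -> words S w 1 [:: i] ->
       Omega_of S [:: j] (th^ n w) ->
       cyl S w [:: i] `&` iter n shiftNN @^-1` cyl S (th^ n w) [:: j] !=set0 }.

Lemma ae_mixing : mixing S -> {ae P, forall w, forall i j,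
  global_words S 1 [:: i] -> global_words S 1 [:: j] ->
    exists N : nat, forall n, (N <= n)%N -> words S w 1 [:: i] ->
       Omega_of S [:: j] (th^ n w) ->
       cyl S w [:: i] `&` iter n shiftNN @^-1` cyl S (th^ n w) [:: j] !=set0}.
Proof.
move=> mixS; apply: ae_foralln => i; apply: ae_foralln => j.
have [gi|gi] := pselect (global_words S 1 [:: i]); last by apply: nearW.
have [gj|gj] := pselect (global_words S 1 [:: j]); last by apply: nearW.
have [N [_ HN]] := mixS _ _ gi gj.
by apply: filterS HN => w Hw _ _; exists (N w).
Qed.

Lemma ae_regular (Obi Obp : set Omega) (I : set nat) (phi : Omega -> NN -> R)
    (r : R) (kappa : Omega -> R) (star : set Omega)
    (mu : Omega -> set NN -> \bar R) (o : Omega -> nat) :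
  bip S Obi Obp I -> holder_hat S phi r kappa Obi Obp ->
  {ae P, forall w, forall x, Xfib S (theta S w) x ->
            ruelle S phi w (cst 1%E) x = 1%E} ->
  random_probability S mu ->
  {ae P, forall w, is_ruelle_dual S phi w (mu (theta S w)) (mu w)} ->
  {ae P, forall w, W1 S w (o w)} -> positive_measure P star ->
  {ae P, forall w, regular phi r kappa Obi Obp star mu o w}.
Proof.
move=> hbip hphi h1 hmu h2 h6 [E [mE Estar E0]].
have h3 := rp_ae hmu.
have h4 := Defs.variation_le (hat_holder hphi).
have h5 := hat_variation1 hphi.
have h7 := ae_successor.
have h8 := ae_recurrence (base_automorphism S) (bip_bp_measurable hbip) (bip_bp_positive hbip).
(* Recurrence is applied to a measurable subset [E] of [star], as [star] itself is not known to be
   measurable. *)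
have h9 := ae_recurrence (base_automorphism S) mE E0.
have h10 := ae_letter_global.
have h11 := ae_mixing (bip_mixing hbip).
have aeI (A B : Omega -> Prop) : {ae P, forall w, A w} -> {ae P, forall w, B w} ->
  {ae P, forall w, A w /\ B w} by apply: filterS2 => w.
have := aeI _ _ (aeI _ _ (aeI _ _ h1 h2) (aeI _ _ h3 h4))
  (aeI _ _ (aeI _ _ (aeI _ _ h5 h6) (aeI _ _ h7 h8)) (aeI _ _ h9 (aeI _ _ h10 h11))).
apply: filterS => w [[[? ?] [[? ?] ?]] [[[? ?] [? ?]] [h9w [? ?]]]]; split => //.
by move=> N; have [n Nn En] := h9w N; exists n => //; exact: Estar.
Qed.

End regular_points.

(** * Decay of the mixing coefficients at regular points *)

Section psi_decay.
Context {d : measure_display} {Omega : measurableType d} {R : realType}.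
Context {P : probability Omega R}.
Variable S : randomTMC P.
Variables (Obi Obp : set Omega) (I : set nat).
Hypothesis hbip : bip S Obi Obp I.
Variable phi : Omega -> NN -> R.
Hypothesis phi_measurable :
  measurable_fun (Xtot S) (fun p : Omega * NN => phi p.1 p.2).
Variables (r : R) (kappa : Omega -> R).
Hypothesis r_gt0 : 0 < r.
Hypothesis r_lt1 : r < 1.
Hypothesis kappa_ge0 : forall w, 0 <= kappa w.
Variable mu : Omega -> set NN -> \bar R.
Variable o : Omega -> nat.
Variables (Bstar Cstar : R).
Hypothesis Bstar_ge1 : 1 <= Bstar.
Hypothesis Cstar_gt0 : 0 < Cstar.
Implicit Types (w : Omega) (x y z : NN).

Local Notation "'th^' n" := (iter n (theta S)) (at level 2, n at level 1).
Local Notation "'thV^' n" := (iter n (thetaV S)) (at level 2, n at level 1).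
Local Notation X := (Xfib S).
Local Notation star := (Omega_star S Obp I o phi r kappa Bstar Cstar).
Local Notation mm := (m_ S Obp I o).
Local Notation nn := (n_ S Obp I o phi r kappa Bstar Cstar).
Local Notation ll := (l_ S Obp I o phi r kappa Bstar Cstar).
Local Notation hsum := (holder_sum S r kappa).
Local Notation t := (1 - Cstar / (2 * Bstar)).

Variable G : set Omega.
Hypothesis G_regular :
  forall w, G w -> regular S phi r kappa Obi Obp star mu o w.
Hypothesis G_theta : forall w, G w -> G (theta S w).
Hypothesis G_thetaV : forall w, G w -> G (thetaV S w).

Let b w := fine (hsum w).

Let G_it n w : G w -> G (th^ n w).
Proof. exact: G_iter. Qed.

Let G_itV n w : G w -> G (thV^ n w).
Proof. by move=> Gw; elim: n => [//|n IH]; exact: G_thetaV. Qed.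

Let thK : cancel (theta S) (thetaV S).
Proof. exact: theta_cancel (base_automorphism S). Qed.

Let thVK : cancel (thetaV S) (theta S).
Proof. exact: thetaV_cancel (base_automorphism S). Qed.

Lemma holder_sum_lty_theta w : (hsum (theta S w) < +oo)%E -> (hsum w < +oo)%E.
Proof.
rewrite holder_sum_theta// !ltey; apply: contraNN => /eqP ->.
by rewrite addey// gt0_muley.
Qed.

(* Orbits visit [star], where the sum is bounded by definition. *)
Lemma holder_sum_fin w : G w -> hsum w = (b w)%:E.
Proof.
move=> Gw; rewrite /b fineK// ge0_fin_numE; last exact: holder_sum_ge0.
have [n _ [Bn _]] := reg_star (G_regular Gw) 0.
have : (hsum (th^ n w) < +oo)%E.
  rewrite ltey; apply/negP => /eqP Hn.
  have : (B_ S r kappa (th^ n w) <= Bstar%:E)%E by [].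
  by rewrite /B_ -/(hsum _) Hn /= leye_eq.
elim: n w {Gw Bn} => [//|n IH] w; rewrite iterSr => /IH.
exact: holder_sum_lty_theta.
Qed.

Let b_ge0 w : 0 <= b w.
Proof. by rewrite /b fine_ge0// holder_sum_ge0. Qed.

Let b_theta w : G w -> b (theta S w) = r * (b w + kappa w).
Proof.
by move=> Gw; rewrite /b holder_sum_theta// (holder_sum_fin Gw)/= addrC.
Qed.

Let B_E w : G w -> B_ S r kappa w = (expR (b w))%:E.
Proof. by move=> Gw; rewrite /B_ -/(hsum _) holder_sum_fin. Qed.

Let G_ruelle1 w : G w ->
  forall x, X (theta S w) x -> ruelle S phi w (cst 1%E) x = 1%E.
Proof. by move=> /G_regular /reg_ruelle1. Qed.

Let phi_variation w : G w -> forall n x y, (2 <= n)%N ->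
  X w x -> X w y -> (forall i, (i < n)%N -> x i = y i) ->
  phi w x <= phi w y + kappa w * r ^+ n.
Proof.
move=> /G_regular Gw n x y n2 xX yX xy.
have : (`|phi w x - phi w y|%:E <= (kappa w * r ^+ n)%:E)%E.
  apply: le_trans (reg_variation Gw n2).
  by apply: ereal_sup_ubound; exists x, y; split.
by rewrite lee_fin => /(le_trans (ler_norm _)); rewrite lerBlDl.
Qed.

Let star_b w : G w -> star w -> expR (b w) <= Bstar.
Proof. by move=> Gw [+ _]; rewrite B_E// lee_fin. Qed.

Lemma regular_extend w j : G w -> W1 S w j -> exists2 x, X w x & x 0%N = j.
Proof.
move=> Gw; apply: Xfib_extend => n i.
by move=> /(reg_successor (G_regular (G_it n Gw))).
Qed.

Lemma regular_m_mem w : G w -> let m := mm w in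
  [/\ (1 <= m)%N, Obp (th^ m w) &
  forall j, (I `&` W1 S (th^ m.-1 w)) j -> (1 <= mxprod S m.-1 w (o w) j)%E].
Proof.
move=> Gw; have wR := G_regular Gw; apply: (m_mem hbip); last exact: reg_Obp wR.
move=> j Ij; have go := reg_global wR (reg_o wR).
(* A letter that is not globally admissible never occurs along a regular orbit. *)
have [gj|gj] := pselect (global_words S 1 [:: j]); last first.
  by exists 0%N => n _ /(reg_global (G_regular (G_it n Gw))).
have [N HN] := reg_mixing wR go gj; exists N => n Nn wj.
have [||x [[xX xo] [_ xj]]] := HN _ Nn.
- by split => // -[|i]// _; exact: reg_o wR.
- have [x xX x0] := regular_extend (G_it n Gw) wj.
  by exists x; split => // -[|].
exists x; split => //; first exact: (xo 0%N).
by have := xj 0%N isT; rewrite iter_shiftNNE addn0.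
Qed.

Let star_branch w : G w -> star w ->
  forall y, X (th^ (mm w) w) y -> exists z, [/\ X w z, z 0%N = o w,
    iter (mm w) shiftNN z = y & Cstar <= expR (birkhoff S phi (mm w) w z)].
Proof.
move=> Gw [_ CC]; apply: (C_branch hbip) => //.
- exact: reg_o (G_regular Gw).
- exact: regular_m_mem.
Qed.

(** The orbit visits [star], where some branch has weight at least [Cstar]; normalization bounds
    every branch weight by 1. *)
Lemma Cstar_le1 w : G w -> Cstar <= 1.
Proof.
move=> Gw; have [n _ sn] := reg_star (G_regular Gw) 0.
have Gn := G_it n Gw; set v := th^ n w in sn Gn.
have Gm := G_it (mm v) Gn.
have [y yX _] := regular_extend Gm (reg_o (G_regular Gm)).
have [z [zX _ zy /le_trans]] := star_branch Gn sn yX; apply.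
have := transfern_branch G_theta G_ruelle1 (mm v) Gn
  (bounded_on_cst (S := S) (w := v) ler01) zX.
by rewrite mulr1 zy (transfern_cst G_theta G_ruelle1 Gn ler01 yX).
Qed.

Let n_mem w : G w -> star (th^ (nn w) w) /\
  (Num.floor (- ln (4 * fine (B_ S r kappa w)) / ln r) + 1 <= (nn w)%:Z)%R.
Proof.
move=> Gw; apply: (@nat_min_mem [set n | star (th^ n w) /\
  (Num.floor (- ln (4 * fine (B_ S r kappa w)) / ln r) + 1 <= n%:Z)%R]).
set F := Num.floor _ + 1.
have [n Fn sn] := reg_star (G_regular Gw) `|F|%N.
exists n; split => //; apply: (@le_trans _ _ `|F|%:Z).
  by rewrite abszE ler_norm.
by rewrite lez_nat.
Qed.

(** The time [nn w] exceeds [- ln (4 * B) / ln r]; multiplying by the negative number [ln r]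
    reverses the inequality. *)
Let n_small w : G w -> 4 * expR (b w) * r ^+ (nn w) <= 1.
Proof.
move=> Gw; have [_] := n_mem Gw; rewrite B_E//=; set n := nn w.
set u := - ln _ / ln r => un.
have lnr : ln r < 0 by rewrite ln_lt0// r_gt0.
have un' : u < n%:R.
  have := floorD1_gt u; apply: contraTT; rewrite -!leNgt.
  rewrite -(ler_int R) in un; apply: le_trans.
  by move: un; rewrite -pmulrn.
have e0 : 0 < 4 * expR (b w) by rewrite mulr_gt0 ?expR_gt0.
rewrite -ler_ln ?posrE ?mulr_gt0 ?exprn_gt0 ?expR_gt0//.
rewrite ln1 lnM ?posrE ?exprn_gt0// lnXn//.
move: un'; rewrite /u ltr_ndivrMr// -mulr_natl; lra.
Qed.

Variable nu : Omega -> probability NN R.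
Hypothesis mu_nu : forall w, G w -> mu w = nu w.

Let G_dual w : G w -> is_ruelle_dual S phi w (nu (theta S w)) (nu w).
Proof.
by move=> Gw; rewrite -!mu_nu//; [exact: reg_dual (G_regular Gw)|exact: G_theta].
Qed.

Let G_support w : G w -> msupport (nu w) = X w.
Proof. by move=> Gw; rewrite -mu_nu//; exact: reg_support (G_regular Gw). Qed.

Definition word_mass_bound (M : R) : set Omega := [set w |
  forall (a : seq nat) (j : nat), let v := thV^ (size a) w in
  (mu v (cylinder a `&` iter (size a) shiftNN @^-1` cylinder [:: j]) <=
   M%:E * mu v (cylinder a) * mu w (cylinder [:: j]))%E].

(** The density of a word of mass [q] starts with oscillation [M * M * q], which the return sequence
    shrinks by [t ^+ n]. The excess mass on [A] is then at most this number times the mass of [A],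
    and dividing by both masses removes [q]. *)
Lemma psi_le w (M : R) n : G w -> 1 <= M -> expR (b w) <= M ->
  word_mass_bound M w ->
  (psi S mu (ll n w) w <= (M * M * t ^+ n)%:E)%E.
Proof.
move=> Gw M1 bM massM; apply: ge_ereal_sup => _ [k [a [A [wa mA AX [a0 A0] ->]]]].
rewrite lee_fin.
have [sa _ _] := wa.
set v := thV^ k w in wa a0 *.
have Gv : G v by exact: G_itV.
have vw : th^ k v = w by exact: iter_thetaVK.
set l := ll n w; have Gl : G (th^ l w) := G_it l Gw.
have C1 := Cstar_le1 Gw.
have t0 : 0 <= t.
  have : Cstar / Bstar <= 1.
    by rewrite ler_pdivrMr ?(lt_le_trans ltr01)// mul1r (le_trans C1).
  by rewrite invfM; lra.
have ma := cylinder_measurable a.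
have mB : measurable (iter (k + l) shiftNN @^-1` A).
  by rewrite -[X in measurable X]setTI; exact: iter_shiftNN_measurable.
(* A fibrewise cylinder is a full cylinder cut by the fibre, which has full measure. *)
have cylE B : measurable B -> nu v (cyl S v a `&` B) = nu v (cylinder a `&` B).
  move=> mB'; rewrite -[cyl S v a]/(X v `&` cylinder a) -setIA.
  by rewrite (measure_Xfib G_support)//; exact: measurableI.
have cylaE : nu v (cyl S v a) = nu v (cylinder a).
  by have := cylE _ measurableT; rewrite !setIT.
move: a0 A0; rewrite !mu_nu// cylE// cylaE => a0 A0.
set q := fine (nu v (cylinder a)); set p := fine (nu _ A).
have fin (u : Omega) (B : set NN) : measurable B -> nu u B \is a fin_num.
  by move=> mB'; exact: fin_num_measure.
have q0 : 0 < q by rewrite fine_gt0// a0 ltey_eq fin.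
have p0 : 0 < p by rewrite fine_gt0// A0 ltey_eq fin.
have qp0 : 0 < q * p by rewrite mulr_gt0.
have osc : oscillation_le S r b w (M * M * q) (transfern S phi k v \1_(cylinder a)).
  rewrite -vw -sa; apply: (word_oscillation phi_measurable G_theta G_ruelle1
    G_dual G_support r_gt0 r_lt1 b_ge0 b_theta phi_variation) => //.
    by rewrite sa vw.
  move=> j; have := massM a j; rewrite sa -/v vw.
  by rewrite /= !mu_nu.
have Mq0 : 0 <= M * M * q by rewrite !mulr_ge0 ?ltW// (lt_le_trans ltr01).
have klE : th^ (k + l) v = th^ l w by rewrite addnC iterD vw.
have := word_mixing_le phi_measurable G_theta G_ruelle1 G_dual G_support
  (n := (k + l)%N) (a := a) Gv (delta := t ^+ n * (M * M * q)) _ mA.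
rewrite mulr_ge0 ?exprn_ge0// klE => /(_ isT) H.
have {}H := H _.
rewrite ler_pdivrMr// lerBlDr -lee_fin fineK; last by apply: fin; exact: measurableI.
apply: le_trans (H _) _.
  move=> x y xX yX; rewrite !transfernD vw.
  exact: (transfern_l_oscillation G_theta G_ruelle1 r_gt0 r_lt1 b_ge0 b_theta
    phi_variation Bstar_ge1 Cstar_gt0 (fun w Gw => (n_mem Gw).1) n_small star_b
    star_branch).
rewrite -[nu (th^ l w) A]fineK ?fin// -EFinM lee_fin -/p -/q.
by rewrite le_eqVlt; apply/orP; left; apply/eqP; ring.
Qed.

Lemma word_mass_bound_exists w : G w -> Obi w ->
  exists K : R, forall M, K <= M -> word_mass_bound M w.
Proof.
move=> Gw wbi; have Gu := G_thetaV Gw; set u := thetaV S w in Gu.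
have uw : theta S u = w by exact: thVK.
have : (Defs.variation S phi 1 u < +oo)%E.
  by apply: (reg_variation1 (G_regular Gu)); rewrite /= uw; left.
(* A point in the fibre excludes the value [-oo] for the supremum defining the variation. *)
have [y yX _] := regular_extend Gu (reg_o (G_regular Gu)).
have V0 : (0 <= Defs.variation S phi 1 u)%E.
  by apply: ereal_sup_ubound; exists y, y; split => //; rewrite subrr normr0.
move=> Vfin; pose V := fine (Defs.variation S phi 1 u).
have uV x x' : X u x -> X u x' -> x 0%N = x' 0%N -> phi u x <= phi u x' + V.
  move=> xX x'X xx'; have : (`|phi u x - phi u x'|%:E <= V%:E)%E.
    rewrite fineK ?ge0_fin_numE//; apply: ereal_sup_ubound.
    by exists x, x'; split => // -[|].
  by rewrite lee_fin => /(le_trans (ler_norm _)); rewrite lerBlDl.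
have [|K K0 HK] := word_mixing_bound phi_measurable G_theta G_ruelle1 G_dual
  G_support r_gt0 b_ge0 b_theta phi_variation Gu uV (bip_finite hbip).
  move=> c uc; have [i Ii [_ wi ai]] := bip_bi hbip wbi uc.
  have wi1 : W1 S (theta S u) i by exact: (wi 1%N).
  have [x xX xi] := regular_extend (G_theta Gu) wi1.
  by exists x; rewrite xi; split => //; exact: (ai 0%N).
(* The bound by 1 serves the empty word, which [word_mixing_bound] leaves out. *)
exists (Num.max 1 K) => M; rewrite ge_max => /andP[M1 KM] a j; cbv zeta.
have Gv : G (thV^ (size a) w) by exact: G_itV.
case: a Gv => [|c a] Gv.
  rewrite /= (_ : cylinder [::] = setT) ?setTI; last by apply/seteqP; split.
  by rewrite mu_nu// probability_setT mule1 lee_pemull.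
set k := size a; have sa : size (c :: a) = k.+1 by [].
have vu : th^ k (thV^ k.+1 w) = u by rewrite iterSr iter_thetaVK.
have := HK _ _ _ Gv vu sa j; rewrite uw.
rewrite (mu_nu Gv) (mu_nu Gw) => /le_trans; apply.
by rewrite !lee_wpmul2r// lee_fin.
Qed.

End psi_decay.

(** * Measurability and monotonicity of the mass bound *)

Section word_mass.
Context {d : measure_display} {Omega : measurableType d} {R : realType}.
Context {P : probability Omega R}.
Variable S : randomTMC P.
Variable mu : Omega -> set NN -> \bar R.
Hypothesis hmu : random_probability S mu.

Lemma word_mass_bound_measurable (M : R) : measurable (word_mass_bound S mu M).
Proof.
pose E (a : seq nat) j := [set w | let v := iter (size a) (thetaV S) w in
  (mu v (cylinder a `&` iter (size a) shiftNN @^-1` cylinder [:: j]) <=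
   M%:E * mu v (cylinder a) * mu w (cylinder [:: j]))%E].
have mE a j : measurable (E a j).
  have mua B : measurable B ->
      measurable_fun setT (fun w => mu (iter (size a) (thetaV S) w) B).
    move=> mB; apply: (measurableT_comp (rp_measurable hmu mB)).
    exact: iter_thetaV_measurable.
  have ma := cylinder_measurable a; have mj := cylinder_measurable [:: j].
  rewrite -[X in measurable X]setTI; apply: measurable_lee => //.
    apply: mua; apply: measurableI => //; rewrite -[X in measurable X]setTI.
    exact: iter_shiftNN_measurable.
  apply: emeasurable_funM; last exact: (rp_measurable hmu mj).
  by apply: emeasurable_funM => //; exact: mua.
(* Words are enumerated through [pickle]; a code of no word contributes the whole space. *)
have -> : word_mass_bound S mu M =
    \bigcap_n \bigcap_j (if @unpickle (seq nat) n is Some a then E a j else setT).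
  apply/seteqP; split => [w wM n _ j _|w wM a j].
    by case: unpickle => // a; exact: wM.
  by have := wM (pickle a) I j I; rewrite pickleK.
apply: bigcapT_measurable => n; apply: bigcapT_measurable => j.
by case: unpickle => // a; exact: mE.
Qed.

Lemma le_word_mass_bound (M M' : R) : M <= M' ->
  word_mass_bound S mu M `<=` word_mass_bound S mu M'.
Proof.
move=> MM w wM a j; apply: le_trans (wM a j) _.
have mu0 v B : measurable B -> (0 <= mu v B)%E.
  by move=> mB; have /andP[] := rp_01 hmu v mB.
rewrite !lee_wpmul2r ?lee_fin// mu0//; exact: cylinder_measurable.
Qed.

End word_mass.

(** * Choice of the set of positive measure and conclusion *)

Theorem mainTheorem10 (d : measure_display) (Omega : measurableType d)
  (R : realType) (P : probability Omega R) (S : randomTMC P)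
  (Omega_bi Omega_bp : set Omega) (I : set nat)
  (hbip : bip S Omega_bi Omega_bp I)
  (phi : Omega -> NN -> R)
  (phi_measurable : measurable_fun (Xtot S) (fun p : Omega * NN => phi p.1 p.2))
  (r : R) (r_gt0 : 0 < r) (r_lt1 : r < 1) (kappa : Omega -> R)
  (hphi : holder_hat S phi r kappa Omega_bi Omega_bp)
  (hL1 : {ae P, forall w, forall x, Xfib S (theta S w) x ->
            ruelle S phi w (cst 1%E) x = 1%E})
  (mu : Omega -> set NN -> \bar R) (hmu : random_probability S mu)
  (hLmu : {ae P, forall w, is_ruelle_dual S phi w (mu (theta S w)) (mu w)})
  (o : Omega -> nat) (o_measurable : measurable_fun setT o)
  (o_W1 : {ae P, forall w, W1 S w (o w)})
  (Bstar Cstar : R) (Bstar_ge1 : 1 <= Bstar) (Cstar_gt0 : 0 < Cstar)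
  (hstar : positive_measure P
     (Omega_star S Omega_bp I o phi r kappa Bstar Cstar)) :
  let t := 1 - Cstar / (2 * Bstar) in
  exists (Omega' : set Omega) (C : R),
    [/\ measurable Omega', Omega' `<=` Omega_bi, (0 < P Omega')%E, 0 < C
      & forall w, Omega' w -> forall n : nat,
          (psi S mu
             (l_ S Omega_bp I o phi r kappa Bstar Cstar n w) w
           <= (C * t ^+ n)%:E)%E].

Proof.
move=> t.
have kappa0 := kappa_ge0 (hat_holder hphi).
set star := Omega_star _ _ _ _ _ _ _ _ _ in hstar.
have [G [Greg Gth GthV [N [mN N0 GN]]]] := ae_invariant_set (base_automorphism S)
  (ae_regular hbip hphi hL1 hmu hLmu o_W1 hstar).
have inG w : ~ N w -> G w by move=> nN; apply: contrapT => nG; apply: nN; exact: GN.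
(* Outside [G] the values of [mu] need not be measures; a Dirac mass is a placeholder there. *)
have /choice[nu mu_nu] : forall w, exists nu : probability NN R, G w -> mu w = nu.
  move=> w; have [Gw|nG] := pselect (G w).
    by have [nu nuE] := reg_probability (Greg _ Gw); exists nu.
  by exists (dirac (cst 0%N : NN)).
(* Removing the measurable null set [N], instead of intersecting with [G], keeps [F m] both
   measurable and inside [G]. *)
pose F (m : nat) := (Omega_bi `&` word_mass_bound S mu m%:R `&`
  [set w | (holder_sum S r kappa w <= m%:R%:E)%E]) `\` N.
have mbi := bip_bi_measurable hbip.
have mF m : measurable (F m).
  apply: measurableD => //; apply: measurableI.
    by apply: measurableI => //; exact: word_mass_bound_measurable hmu _.
  rewrite -[X in measurable X]setTI; apply: measurable_lee => //.
  exact: holder_sum_measurable (kappa_measurable (hat_holder hphi)).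
have sumE w : G w -> holder_sum S r kappa w = (fine (holder_sum S r kappa w))%:E.
  exact: (holder_sum_fin r_gt0 kappa0 Greg).
have biF : Omega_bi `\` N `<=` \bigcup_m F m.
  move=> w [wbi wN]; have Gw := inG _ wN.
  have [K HK] := word_mass_bound_exists hbip phi_measurable r_gt0 kappa0 Greg Gth
    GthV mu_nu Gw wbi.
  pose K' := Num.max K (fine (holder_sum S r kappa w)).
  exists (Num.truncn K').+1 => //; have KK := ltW (truncnS_gt K').
  split => //; split; first split => //.
    by apply: HK; apply: le_trans KK; rewrite le_max lexx.
  by rewrite /= sumE// lee_fin (le_trans _ KK)// le_max lexx orbT.
(* The sets [F m] cover [Omega_bi] up to a null set, so they cannot all be null. *)
have [m Fm] : exists m, (0 < P (F m))%E.
  apply: contrapT => /forallNP F0.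
  have nF : P.-negligible (\bigcup_m F m).
    apply: negligible_bigcup => m; apply/negligibleP => //.
    by apply/eqP; rewrite eq_le measure_ge0 andbT leNgt; apply/negP/F0.
  have /negligibleP : P.-negligible (Omega_bi `\` N) by exact: negligibleS nF.
  move=> /(_ (measurableD mbi mN)) bi0.
  have biE : P (Omega_bi `\` N) = P Omega_bi by exact: measureD_null.
  by have := bip_bi_positive hbip; rewrite -biE bi0 ltxx.
(* The choice [M = expR m] satisfies all three demands on [M]: it is at least 1, it dominates [expR]
   of the Hölder sum, which is at most [m], and it exceeds the mass bound [m]. *)
exists (F m), (expR m%:R * expR m%:R); split => //.
  by move=> w [[[]]].
move=> w [[[wbi wM] ws] wN] n; have Gw := inG _ wN.
apply: (psi_le hbip phi_measurable r_gt0 r_lt1 kappa0 Bstar_ge1 Cstar_gt0 Greg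
  Gth GthV mu_nu) => //.
- by rewrite -expR0 ler_expR.
- by rewrite ler_expR -lee_fin -sumE.
- apply: le_word_mass_bound wM => //.
  by rewrite (le_trans _ (expR_ge1Dx _))// lerDr.
Qed.
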